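(* Let $F\in\mathcal{D}(\Lambda)$ be a distribution function with density $f$, and let $\eta,u,h,a_n,b_n,g_n$ be as defined in the context. Assume that $(1/\eta')'(x)\to 0$ as $x\to r(F)$. Suppose there exist $k>0$ and $n_0$ such that for all $n\ge n_0$ $$\frac{u(b_n)}{b_n\,h(b_n)}\le k,$$ and that there are constants $b>0$, $d>0$ such that, for every $c<k^{-1}$ and every $n\ge n_0$ for which $b_n(1-ck)\in(l(F),r(F))$, $$\frac{h(b_n(1-ck))}{h(b_n)}\le d\,(1-ck)^{-b}.$$ Let $\beta>1$. If $\sup_{x\in\mathbb{R}}f(x)<\infty$, $f$ is decreasing near $r(F)$, and $\int_{\mathbb{R}}(f(x))^\beta\,dx<\infty$, then for large $n$ $$|H_\beta(g_n)-H_\beta(\lambda)|\le O(h(b_n))+O(\log(1+h(b_n)))+O\left(n e^{-n^{1/2}}\right),$$ i.e. there exist constants $C>0$ and $N$ such that for all $n\ge N$ the left-hand side is at most $C\left[h(b_n)+\log(1+h(b_n))+n e^{-n^{1/2}}\right]$.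
   Context: For a probability density $p$ and $\beta>0$, $\beta\ne1$, the Rényi entropy of order $\beta$ is $H_\beta(p)=\frac{1}{1-\beta}\log\left(\int_{\{p>0\}}(p(x))^\beta\,dx\right)$. $\Lambda(x)=\exp(-e^{-x})$, $x\in\mathbb{R}$, is the Gumbel law, with density $\lambda(x)=e^{-x}e^{-e^{-x}}$. $F\in\mathcal{D}(\Lambda)$ means that there are norming constants $\alpha_n>0$, $\beta_n\in\mathbb{R}$ with $F^n(\alpha_n x+\beta_n)\to\Lambda(x)$ for all $x$. Put $l(F)=\inf\{x:F(x)>0\}$ and $r(F)=\sup\{x:F(x)<1\}$. Standing setting: $F$ is twice differentiable on $(l(F),r(F))$ with density $f=F'>0$ there. Write $F(x)=\exp\{-e^{-\eta(x)}\}$, i.e. $\eta(x)=-\log(-\log F(x))$, and set $u(x)=1/\eta'(x)$. One has $$(1/\eta')'(x)=-\log F(x)-\left[1-\frac{F(x)f'(x)\log F(x)}{(f(x))^2}\right].$$ Define the nonincreasing function $h(x)=\sup_{x<y<r(F)}|(1/\eta')'(y)|$. The norming constants are $b_n=F^{\leftarrow}(1-\tfrac1n)=\inf\{x:F(x)>1-\tfrac1n\}$ and $a_n=u(b_n)$. With $X_1,X_2,\dots$ i.i.d. with distribution function $F$ and $M_n=\max(X_1,\dots,X_n)$, $g_n(x)=n a_n f(a_nx+b_n)F^{n-1}(a_nx+b_n)$ is the density of $(M_n-b_n)/a_n$. *)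

(* Defs.v *)
From HB Require Import structures.
From mathcomp Require Import all_boot all_order all_algebra.
From mathcomp Require Import all_classical all_reals all_analysis.

Set Implicit Arguments.
Unset Strict Implicit.
Unset Printing Implicit Defensive.

Import Order.TTheory GRing.Theory Num.Theory.
Import numFieldNormedType.Exports.

Local Open Scope classical_set_scope.
Local Open Scope ring_scope.

(* Extended-real valued, since the integral of p^beta may be infinite;
   lne 0 = -oo and lne +oo = +oo. *)
Definition renyi_entropy (R : realType) (beta : R) (p : R -> R) : \bar R :=
  (((1 - beta)^-1)%:E *
   lne (\int[lebesgue_measure]_(x in [set x | 0 < p x]%R) (p x `^ beta)%:E))%E.

Definition gumbel_cdf (R : realType) (x : R) : R := expR (- expR (- x)).

Definition gumbel_pdf (R : realType) (x : R) : R :=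
  expR (- x) * expR (- expR (- x)).

Definition gumbel_domain (R : realType) (F : R -> R) : Prop :=
  exists alpha beta : nat -> R,
    (forall n, 0 < alpha n) /\
    (forall x, F (alpha n * x + beta n) ^+ n @[n --> \oo] --> gumbel_cdf x).

(* f is determined by F only up to a null set. *)
Definition is_density (R : realType) (F f : R -> R) : Prop :=
  [/\ measurable_fun [set: R] f,
      forall x, 0 <= f x &
      forall x, (\int[lebesgue_measure]_(y in `]-oo, x]) (f y)%:E = (F x)%:E)%E].

Definition lend (R : realType) (F : R -> R) : \bar R :=
  ereal_inf [set x%:E | x in [set x | 0 < F x]].

Definition rend (R : realType) (F : R -> R) : \bar R :=
  ereal_sup [set x%:E | x in [set x | F x < 1]].

Definition inner (R : realType) (F : R -> R) (x : R) : Prop :=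
  (lend F < x%:E < rend F)%E.

(* The filter "x -> r from below" for an extended real r: left neighbourhoods
   of r when r is finite, neighbourhoods of +oo when r = +oo. *)
Definition at_left_ereal (R : realType) (r : \bar R) : set_system R :=
  filter_from [set x0 : R | (x0%:E < r)%E]
              (fun x0 => [set x | x0 < x /\ (x%:E < r)%E]).

Section extreme_value.
Variables (R : realType) (F : R -> R).

Definition eta (x : R) : R := - ln (- ln (F x)).

Definition aux_u (x : R) : R := ((eta^`())%classic x)^-1.

Definition aux_u' : R -> R := (aux_u^`())%classic.

(* Extended-real valued: aux_u' need not be bounded on `]x, rend F[.
   Quotients with h are quotients of \bar R, where the inverse of 0 is +oo: an
   upper bound u / (b_n * h(b_n)) <= k then forces b_n * h(b_n) != 0. *)
Definition aux_h (x : R) : \bar R :=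
  ereal_sup [set `|aux_u' y|%:E | y in [set y | x < y /\ (y%:E < rend F)%E]].

(* Meaningful for n >= 2 only: inf is 0 on sets without infimum in R. *)
Definition norm_b (n : nat) : R := inf [set x | F x > 1 - n%:R^-1].

Definition norm_a (n : nat) : R := aux_u (norm_b n).

(* The density of (M_n - b_n) / a_n, for M_n the maximum of n i.i.d. random
   variables of distribution function F and density f. *)
Definition max_pdf (f : R -> R) (n : nat) (x : R) : R :=
  n%:R * norm_a n * f (norm_a n * x + norm_b n)
  * F (norm_a n * x + norm_b n) ^+ n.-1.

End extreme_value.

(* Main.v *)
Require Import Defs.
From HB Require Import structures.
From mathcomp Require Import all_boot all_order all_algebra.
From mathcomp Require Import all_classical all_reals all_analysis.
From mathcomp Require Import measurable_realfun ring lra.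

Import Order.TTheory GRing.Theory Num.Theory.
Import numFieldNormedType.Exports.

Local Open Scope classical_set_scope.
Local Open Scope ring_scope.

(* Put u = 1/eta', t(y) = eta(y) - ln n and a_n = u(b_n). The density of the
   maximum satisfies n a_n f(y) F(y)^(n-1) = gumbel_pdf(t(y)) a_n / u(y), and dt/dy = 1/u,
   so the integral of g_n^beta is the integral of gumbel_pdf(t)^beta (a_n / u)^(beta - 1) dt,
   and everything reduces to showing that a_n / u(y) is close to 1 for
   y >= y1, where y1 is fixed; below y1 the factor F^(n-1) is geometrically small.

   By the mean value theorem ln u varies, as a function of eta, at speed |u'| <= h.
   The two ratio hypotheses force the right endpoint to be infinite and give
   h(y) <= d (y / b_n)^(-b) h(b_n) and u(y) = O(y^(1 - b)). The latter says that y^b is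
   Lipschitz in eta; hence (b_n / y)^b = O(1 + tau) with tau = |eta(y) - eta(b_n)|,
   so h(y) = O(h(b_n) (1 + tau)), and |ln (a_n / u(y))| = O(h(b_n) tau (1 + tau)). The
   Gumbel weight absorbs the polynomial in tau, and the error is O(h(b_n)). *)

(** * Changes of variables *)

(** The obstacle is that the error O(h(b_n) tau (1 + tau)) in ln (a_n / u) is quadratic in tau, so
    its exponential could not be integrated against the Gumbel density, whose right tail is only
    e^(-t). Two bounds are therefore carried along. The quadratic one has a coefficient of order
    h(b_n) and supplies the rate; the other is linear in tau, with a small coefficient that does not
    depend on n. In |e^w - 1| <= |w| e^|w| the former bounds |w| and the latter e^|w|. The threshold
    y1 = b_N is taken so far out that h(y1) is below this small coefficient, 1 / (4 beta), which
    makes e^|w| at most e^(tau / 4). Below y1 no comparison of u with a_n is available. There the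
    finite integral of f^beta, the bound a_n = O(n) and F <= F(y1) < 1 give a power of n times a
    geometric sequence, which is O(n e^(-sqrt n)). Since the hypotheses concern only the points b_n,
    bounds on u at a general y come from a neighbouring b_n, at bounded distance on the scale of
    eta. *)

(** The image of Lebesgue measure under x -> a x + b, multiplied by a, gives half-open intervals
    their length, so it is Lebesgue measure by uniqueness. *)
Lemma ge0_integral_affine (R : realType) (a b : R) (f : R -> R) :
  0 < a -> measurable_fun [set: R] f -> (forall x, 0 <= f x) ->
  (\int[lebesgue_measure]_x (f (a * x + b)%R)%:E =
   a^-1%:E * \int[lebesgue_measure]_x (f x)%:E)%E.
Proof.
move=> a0 mf f0.
pose phi (x : measurableTypeR R) : measurableTypeR R := a * x + b.
have mphi : measurable_fun setT phi.
  by apply: measurable_funD; [apply: measurable_funM|].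
pose phim : {mfun measurableTypeR R >-> measurableTypeR R} :=
  HB.pack phi (isMeasurableFun.Build _ _ _ _ _ mphi).
pose c : {nonneg R} := NngNum (ltW a0).
have E A : measurable A -> lebesgue_measure A =
    mscale c (pushforward (@lebesgue_measure R) phim) A.
  move=> mA; apply: (lebesgue_measure_unique (mu := mscale c (pushforward (@lebesgue_measure R) phim))) => //.
  move=> _ [[u v]] _ <-.
  have E : phi @^-1` `]u, v] = `](u - b) / a, (v - b) / a]%classic.
    apply/seteqP; split => x /=; rewrite !in_itv/= /phi ltr_pdivrMr// ler_pdivlMr//;
     rewrite mulrC ltrBlDr lerBrDr//.
  transitivity (a%:E * lebesgue_measure (phi @^-1` `]u, v]))%E; last by [].
  rewrite E.
  rewrite !lebesgue_measure_itv/= !lte_fin ltr_pM2r ?invr_gt0// ltrD2r.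
  case: ifPn => uv; last by rewrite mule0.
  rewrite -EFinB -EFinM; congr EFin; field; exact: lt0r_neq0.
rewrite [in RHS](eq_measure_integral (mscale c (pushforward (@lebesgue_measure R) phim))); last first.
  by move=> A mA _; exact: E.
rewrite ge0_integral_mscale//=;
  [|exact/measurable_EFinP|by move=> x _; rewrite lee_fin].
rewrite [X in (_ * (_ * X))%E](_ : _ = \int[lebesgue_measure]_x (f (a * x + b))%:E)%E.
  by rewrite muleA -EFinM mulVf ?mul1e// gt_eqF.
apply: (@ge0_integral_pushforward _ _ _ _ R phi mphi (@lebesgue_measure R) setT (EFin \o f)) => //.
  exact/measurable_EFinP.
by move=> y _; rewrite lee_fin.
Qed.

Lemma ge0_integral_bndy_cvg (R : realType) (G : R -> R) (a : R) (s : nat -> R) :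
  {within `[a, +oo[, continuous G} -> (forall x, a <= x -> 0 <= G x) ->
  {homo s : m n / (m <= n)%N >-> m <= n} -> s n @[n --> \oo] --> +oo ->
  (\int[lebesgue_measure]_(x in `[a, s n]) (G x)%:E @[n --> \oo] -->
   \int[lebesgue_measure]_(x in `[a, +oo[) (G x)%:E)%E.
Proof.
move=> cG G0 ns sy.
have -> : `[a, +oo[%classic = \bigcup_n `[a, s n]%classic.
  apply/seteqP; split => x /=; rewrite in_itv/= ?andbT.
    move=> ax; have /cvgryPge/(_ x)[n _ /(_ n (leqnn n)) /= xn] := sy.
    by exists n => //=; rewrite in_itv/= ax.
  by move=> [n _] /=; rewrite in_itv/= => /andP[].
apply: ge0_nondecreasing_set_cvg_integral.
- move=> m n mn; rewrite subsetEset => x /=; rewrite !in_itv/= => /andP[-> xm].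
  exact: (le_trans xm (ns _ _ mn)).
- by [].
- move=> n; apply/measurable_EFinP; apply: subspace_continuous_measurable_fun => //.
  apply: continuous_subspaceW cG => x /=; rewrite !in_itv/= => /andP[-> _] //.
- by move=> n x /=; rewrite in_itv/= => /andP[ax _]; rewrite lee_fin G0.
Qed.

(** Substitution holds on each compact interval [a, a + n]; monotone convergence applies to both
    sides, and the two limits coincide. *)
Lemma ge0_integral_substitution_y (R : realType) (psi dpsi G : R -> R) (a : R) :
  (forall x, a <= x -> is_derive x 1 psi (dpsi x)) ->
  (forall x, a <= x -> 0 < dpsi x) ->
  (forall x, a <= x -> {for x, continuous dpsi}) ->
  psi x @[x --> +oo] --> +oo ->
  continuous G -> (forall x, 0 <= G x) ->
  (\int[lebesgue_measure]_(x in `[psi a, +oo[) (G x)%:E =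
   \int[lebesgue_measure]_(x in `[a, +oo[) (G (psi x) * dpsi x)%:E)%E.
Proof.
move=> dP P0 cdP Py cG G0.
have cP x : a <= x -> {for x, continuous psi}.
  move=> ax; apply: differentiable_continuous; apply/derivable1_diffP.
  by have [] := dP x ax.
have P'E x : a <= x -> psi^`()%classic x = dpsi x.
  by move=> ax; rewrite derive1E; have /@derive_val := dP x ax.
have wP (A : set R) : A `<=` `[a, +oo[ -> {within A, continuous psi}.
  move=> sA; apply: continuous_in_subspaceT => x /set_mem /sA /=.
  by rewrite in_itv/= andbT => ax; apply: cP.
have incr : {in `[a, +oo[ &, {homo psi : x y / (x < y)%R}}.
  move=> x y; rewrite !in_itv/= !andbT => ax ay xy.
  have [||c] := @MVT R psi dpsi x y xy.
  - by move=> z; rewrite in_itv/= => /andP[xz _]; apply: dP; rewrite (le_trans ax)// ltW.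
  - by apply: wP => z /=; rewrite !in_itv/= andbT => /andP[xz _]; rewrite (le_trans ax).
  rewrite in_itv/= => /andP[xc cy] E.
  by rewrite -subr_gt0 E mulr_gt0 ?subr_gt0// P0// (le_trans ax)// ltW.
have cH : {within `[a, +oo[, continuous (fun x => G (psi x) * dpsi x)}.
  apply: continuous_in_subspaceT => x /set_mem /=; rewrite in_itv/= andbT => ax.
  apply: continuousM; last exact: cdP.
  by apply: continuous_comp; [exact: cP|exact: cG].
pose s n : R := a + n%:R.
have ns : {homo s : m n / (m <= n)%N >-> m <= n}.
  by move=> m n mn; rewrite lerD2l ler_nat.
have sy : s n @[n --> \oo] --> +oo.
  apply/cvgryPge => A; near=> n; rewrite /s -lerBlDl; near: n.
  exact: nbhs_infty_ger.
have as_ n : a <= s n by rewrite lerDl.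
have H1 := ge0_integral_bndy_cvg _ _ _ s cH _ ns sy.
have H2 := ge0_integral_bndy_cvg R G (psi a) (psi \o s) _ _ _ _.
apply: (cvg_unique _ (H2 _ _ _ _) _) => //; last 1 first.
- have -> : (fun n => \int[lebesgue_measure]_(x in `[psi a, (psi \o s) n]) (G x)%:E)%E =
    (fun n => \int[lebesgue_measure]_(x in `[a, s n]) (G (psi x) * dpsi x)%:E)%E.
    (* At [n = 0] both intervals are a single point, whereas the substitution needs a nondegenerate
       interval. *)
    apply/funext => n /=; case: n => [|n].
      by rewrite /s addr0 !set_itv1 !integral_set1.
    have an : a < s n.+1 by rewrite ltrDl.
    rewrite (@integration_by_substitution_increasing R psi G a (s n.+1))//.
    + apply: eq_integral => x /set_mem /=; rewrite in_itv/= => /andP[ax _].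
      by rewrite -(P'E x ax).
    + by move=> x y; rewrite !in_itv/= => /andP[ax _] /andP[ay _]; apply: incr; rewrite in_itv/= ?ax ?ay.
    + move=> x; rewrite in_itv/= => /andP[ax _].
      have N : \near x, dpsi x = psi^`()%classic x.
        near=> z; rewrite P'E// ltW//; near: z; exact: lt_nbhsr.
      rewrite /continuous_at (P'E x (ltW ax)); apply: (cvg_trans (near_eq_cvg N)).
      exact: (cdP x (ltW ax)).
    + have N : \forall z \near a^'+, dpsi z = psi^`()%classic z.
        by near=> z; rewrite P'E.
      apply/cvg_ex; exists (dpsi a); apply: (cvg_trans (near_eq_cvg N)).
      by apply: cvg_at_right_filter; exact: cdP.
    + have N : \forall z \near (s n.+1)^'-, dpsi z = psi^`()%classic z.
        by near=> z; rewrite P'E//; near: z; exact: nbhs_left_ge.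
      apply/cvg_ex; exists (dpsi (s n.+1)); apply: (cvg_trans (near_eq_cvg N)).
      by apply: cvg_at_left_filter; exact: cdP.
    + split.
      * by move=> x; rewrite in_itv/= => /andP[ax _]; have [] := dP x (ltW ax).
      * by apply: cvg_at_right_filter; exact: cP.
      * by apply: cvg_at_left_filter; apply: cP.
    + exact: continuous_subspaceT.
  by apply: H1 => x ax; rewrite mulr_ge0// ltW// P0.
- exact: continuous_subspaceT.
- move=> m n mn /=; have := ns _ _ mn; rewrite le_eqVlt => /predU1P[->//|smn].
  by apply/ltW/incr => //; rewrite in_itv/= as_.
- exact: (cvg_comp _ _ sy Py).
Unshelve. all: by end_near. Qed.

(** * The Gumbel law *)

Section gumbel.
Variable R : realType.
Implicit Types t x : R.

Lemma gumbel_pdfE t : gumbel_pdf t = expR (- t - expR (- t)).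
Proof. by rewrite /gumbel_pdf expRD. Qed.

Lemma gumbel_pdf_gt0 t : 0 < gumbel_pdf t.
Proof. by rewrite gumbel_pdfE expR_gt0. Qed.

Lemma gumbel_pdf_le1 t : gumbel_pdf t <= 1.
Proof.
rewrite gumbel_pdfE -expR0 ler_expR.
by have := expR_ge1Dx (- t); lra.
Qed.

Lemma is_derive_gumbel_cdf t : is_derive t 1 (@gumbel_cdf R) (gumbel_pdf t).
Proof.
rewrite /gumbel_cdf; apply: is_derive_eq.
by rewrite /gumbel_pdf /GRing.scale/=; ring.
Qed.

Lemma continuous_gumbel_cdf : continuous (@gumbel_cdf R).
Proof.
move=> t; apply: differentiable_continuous; apply/derivable1_diffP.
by have [] := is_derive_gumbel_cdf t.
Qed.

Lemma continuous_gumbel_pdf : continuous (@gumbel_pdf R).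
Proof.
move=> t; apply: differentiable_continuous; apply/derivable1_diffP.
by rewrite /gumbel_pdf.
Qed.

Lemma gumbel_cdf_gt0 t : 0 < gumbel_cdf t.
Proof. exact: expR_gt0. Qed.

Lemma cvgy_gumbel_cdf : @gumbel_cdf R x @[x --> +oo] --> (1:R).
Proof.
have H : @gumbel_cdf R x @[x --> +oo] --> expR (- (0 : R)).
  apply: (@continuous_cvg _ _ _ _ _ (fun x : R => expR (- x)) (fun x => expR (- x))).
    by apply: continuous_comp; [exact: continuousN|exact: continuous_expR].
  exact: cvgr_expR.
by move: H; rewrite oppr0 expR0.
Qed.

Lemma cvgNy_gumbel_cdf : @gumbel_cdf R (- x) @[x --> +oo] --> (0:R).
Proof.
have E : expR (- - x) @[x --> +oo%R] --> (+oo%R : set_system R).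
  under eq_fun do rewrite opprK; apply/cvgryPge => A; near=> x.
  apply: (le_trans _ (expR_ge1Dx _)); near: x; exists (A - 1); split; rewrite ?num_real// => x.
  by rewrite ltrBlDl => /ltW.
exact: (cvg_comp _ _ E (@cvgr_expR R)).
Unshelve. all: by end_near. Qed.

Lemma integral_gumbel_pdf_y t :
  (\int[lebesgue_measure]_(x in `[t, +oo[) (@gumbel_pdf R x)%:E = 1 - (gumbel_cdf t)%:E)%E.
Proof.
apply: ge0_continuous_FTC2y.
- by move=> x _; exact/ltW/gumbel_pdf_gt0.
- exact/continuous_subspaceT/continuous_gumbel_pdf.
- exact: cvgy_gumbel_cdf.
- by move=> x _; have [] := is_derive_gumbel_cdf x.
- by apply: cvg_at_right_filter; exact: continuous_gumbel_cdf.
- by move=> x _; rewrite derive1E; exact: (@derive_val _ _ _ _ _ _ _ (is_derive_gumbel_cdf x)).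
Qed.

Lemma integral_gumbel_pdf_Ny t :
  (\int[lebesgue_measure]_(x in `]-oo, t]) (@gumbel_pdf R x)%:E = (gumbel_cdf t)%:E)%E.
Proof.
rewrite -(opprK t) ge0_integration_by_substitutionNy; last 2 first.
- exact/continuous_subspaceT/continuous_gumbel_pdf.
- by move=> x _; exact/ltW/gumbel_pdf_gt0.
have dN x : is_derive x 1 (fun y => - gumbel_cdf (- y)) (gumbel_pdf (- x)).
  have := is_deriveN (@is_derive1_comp R (@gumbel_cdf R) -%R x _ _
    (is_derive_gumbel_cdf (- x)) (is_deriveNid x 1)).
  by rewrite mulrN1 opprK.
rewrite (@ge0_continuous_FTC2y R _ (fun y => - gumbel_cdf (- y)) _ 0).
- by rewrite -EFinB sub0r !opprK.
- by move=> x _ /=; exact/ltW/gumbel_pdf_gt0.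
- apply: continuous_subspaceT => x; apply: continuous_comp; first exact: continuousN.
  exact: continuous_gumbel_pdf.
- have := cvgN cvgNy_gumbel_cdf; rewrite oppr0; exact.
- by move=> x _; have [] := dN x.
- apply: cvg_at_right_filter; have [+ _] := dN (- t).
  by move=> /derivable1_diffP/differentiable_continuous.
- by move=> x _; rewrite derive1E; exact: (@derive_val _ _ _ _ _ _ _ (dN x)).
Qed.

Lemma integral_setT_split (t : R) (f : R -> R) :
  measurable_fun [set: R] f -> (forall x, 0 <= f x) ->
  (\int[lebesgue_measure]_x (f x)%:E =
   \int[lebesgue_measure]_(x in `]-oo, t[) (f x)%:E +
   \int[lebesgue_measure]_(x in `[t, +oo[) (f x)%:E)%E.
Proof.
move=> mf f0.
have -> : [set: R] = `]-oo, t[%classic `|` `[t, +oo[%classic.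
  by apply/seteqP; split => x //= _; rewrite !in_itv/= andbT; case: (ltP x t); [left|right].
rewrite ge0_integral_setU//=.
- apply/measurable_EFinP; exact: measurable_funTS.
- by move=> x _; rewrite lee_fin.
- rewrite disj_set2E; apply/eqP/seteqP; split => x //=.
  by rewrite !in_itv/= andbT => -[]; rewrite ltNge => /negbTE ->.
Qed.

Lemma integral_gumbel_pdf : (\int[lebesgue_measure]_x (@gumbel_pdf R x)%:E = 1)%E.
Proof.
have m : measurable_fun [set: R] (@gumbel_pdf R).
  by apply: continuous_measurable_fun; exact: continuous_gumbel_pdf.
rewrite (integral_setT_split 0)//; last by move=> x; exact/ltW/gumbel_pdf_gt0.
rewrite integral_itv_bndo_bndc; last by apply/measurable_EFinP; exact: measurable_funTS.
by rewrite integral_gumbel_pdf_Ny integral_gumbel_pdf_y -EFinB -EFinD addrC subrK.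
Qed.

Lemma powR_gumbel_pdf_le (beta t : R) : 1 <= beta -> gumbel_pdf t `^ beta <= gumbel_pdf t.
Proof.
move=> b1; rewrite -[leRHS]powRr1 ?(ltW (gumbel_pdf_gt0 t))//.
by apply: ger_powR => //; rewrite gumbel_pdf_gt0 gumbel_pdf_le1.
Qed.

(** Stretching the density by 2 frees a factor e^(t/2) on the right, and on the left a doubly
    exponential one. The stretched density is still integrable, so this is how growth in tau is
    absorbed. *)
Lemma gumbel_pdf_expR_le t :
  gumbel_pdf t * expR ((`|t| + 1) / 2) <= expR 2 * gumbel_pdf (t / 2).
Proof.
rewrite !gumbel_pdfE -!expRD ler_expR.
have [t0|t0] := leP 0 t.
  rewrite ger0_norm//.
  have : expR (- (t / 2)) <= 1 by rewrite -[leRHS]expR0 ler_expR; lra.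
  by have := expR_gt0 (- t); lra.
(* With v = e^(-t/2) and -t/2 <= v - 1, the claim follows from v^2 - 3 v + 7/2 >= 0. *)
rewrite ltr0_norm//; set v := expR (- (t / 2)).
have -> : expR (- t) = v ^+ 2 by rewrite /v -expRM_natl; congr expR; lra.
have : 1 - t / 2 <= v by have := expR_ge1Dx (- (t/2)); rewrite -/v; lra.
by have := sqr_ge0 (v - 3 / 2); lra.
Qed.

End gumbel.

(** * Growth of u and of h *)

(** The mean value theorem applied to [g - f]. With [g] a multiple of eta it yields Lipschitz bounds
    with respect to eta. *)
Lemma ler_derive_increment (R : realType) (f g df dg : R -> R) (x z : R) :
  x <= z ->
  (forall y, x <= y <= z -> is_derive y 1 f (df y)) ->
  (forall y, x <= y <= z -> is_derive y 1 g (dg y)) ->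
  (forall y, x < y < z -> df y <= dg y) ->
  f z - f x <= g z - g x.
Proof.
rewrite le_eqVlt => /predU1P[->|xz] fd gd le; first by rewrite !subrr.
have cont (h dh : R -> R) : (forall y, x <= y <= z -> is_derive y 1 h (dh y)) ->
    {within `[x, z], continuous h}.
  move=> hd; apply: continuous_in_subspaceT => y /set_mem /=; rewrite in_itv/= => xyz.
  apply: differentiable_continuous; apply/derivable1_diffP.
  by have [] := hd y xyz.
have wk y : x < y < z -> x <= y <= z by move=> /andP[/ltW -> /ltW ->].
have dgf y : x <= y <= z -> is_derive y 1 (g \- f) (dg y - df y).
  by move=> xyz; apply: is_deriveB; [exact: gd|exact: fd].
have [||c] := @MVT R (g \- f) (fun y => dg y - df y) x z xz.
- by move=> y; rewrite in_itv/= => /wk; exact: dgf.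
- exact: cont dgf.
rewrite in_itv/= => xcz /= E.
have : 0 <= g z - f z - (g x - f x).
  by rewrite E mulr_ge0 ?subr_ge0 ?le//; exact: ltW.
lra.
Qed.

Lemma ler_norm_derive_increment (R : realType) (f g df dg : R -> R) (x z : R) :
  x <= z ->
  (forall y, x <= y <= z -> is_derive y 1 f (df y)) ->
  (forall y, x <= y <= z -> is_derive y 1 g (dg y)) ->
  (forall y, x < y < z -> `|df y| <= dg y) ->
  `|f z - f x| <= g z - g x.
Proof.
move=> xz fd gd le; rewrite ler_norml; apply/andP; split.
  rewrite lerNl.
  have -> : - (f z - f x) = - f z - - f x by ring.
  apply: (@ler_derive_increment R (\- f) g (fun y => - df y) dg) => // y xyz.
    by apply: is_deriveN; exact: fd.
  by rewrite (le_trans _ (le _ xyz))// lerNl lerNnormlW.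
apply: (@ler_derive_increment R f g df dg) => // y xyz.
by rewrite (le_trans _ (le _ xyz))// ler_norm.
Qed.

(** * Abstract estimates along a sequence [bn], with a nonincreasing majorant [H] of |u'| *)

Section growth.
Variables (R : realType) (eta u du H : R -> R) (bn : nat -> R) (N : nat).
Variables (b d k : R).
Let y1 := bn N.
Hypothesis y1_gt0 : 0 < y1.
Hypothesis b_gt0 : 0 < b.
Hypothesis d_gt0 : 0 < d.
Hypothesis k_gt0 : 0 < k.
Hypothesis eta_deriv : forall y, y1 <= y -> is_derive y 1 eta (u y)^-1.
Hypothesis u_deriv : forall y, y1 <= y -> is_derive y 1 u (du y).
Hypothesis u_gt0 : forall y, y1 <= y -> 0 < u y.
Hypothesis du_le : forall x y, y1 <= x -> x < y -> `|du y| <= H x.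
Hypothesis H_noninc : forall x y, y1 <= x -> x <= y -> H y <= H x.
Hypothesis H_le1 : H y1 <= 1.
Hypothesis bn_ge : forall n, (N <= n)%N -> y1 <= bn n.
(** This carries bounds known only at the points of the sequence over to every [y]. For b_n the gap
    3 is 1 + 1 + 1: eta(b_n) is within 1 of ln n, and ln (n + 1) - ln n <= 1. *)
Hypothesis bn_step : forall y, y1 <= y -> exists n, [/\ (N <= n)%N,
  bn n <= y, y <= bn n.+1 & eta (bn n.+1) - eta (bn n) <= 3].
Hypothesis H_ratio : forall n y, (N <= n)%N -> y1 <= y ->
  H y <= d * (y / bn n) `^ (- b) * H (bn n).
Hypothesis u_ratio : forall n, (N <= n)%N -> u (bn n) <= k * (bn n * H (bn n)).

Lemma H_ge0 x : y1 <= x -> 0 <= H x.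
Proof.
by move=> x1; apply: (le_trans _ (du_le x (x + 1) x1 _)); rewrite ?ltrDl.
Qed.

Lemma ln_u_increment x z : y1 <= x -> x <= z ->
  `|ln (u z) - ln (u x)| <= H x * (eta z - eta x).
Proof.
move=> x1 xz.
rewrite mulrBr.
apply: (@ler_norm_derive_increment R (fun y => ln (u y)) (fun y => H x * eta y)
  (fun y => (u y)^-1 * du y) (fun y => H x * (u y)^-1)) => // y /andP[xy yz].
- have y1y : y1 <= y by rewrite (le_trans x1).
  by apply: (@is_derive1_comp R _ u y _ _ (is_derive1_ln (u_gt0 y y1y)) (u_deriv y y1y)).
- by have y1y : y1 <= y by [rewrite (le_trans x1)]; exact: (is_deriveZ _ (eta_deriv y y1y)).
- have y1y : y1 <= y by rewrite (le_trans x1)// ltW.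
  rewrite normrM (ger0_norm (_ : 0 <= (u y)^-1)) ?invr_ge0 ?(ltW (u_gt0 y y1y))//.
  by rewrite mulrC ler_wpM2r ?invr_ge0 ?(ltW (u_gt0 y y1y))// du_le.
Qed.

Lemma eta_nondecreasing x z : y1 <= x -> x <= z -> eta x <= eta z.
Proof.
move=> x1 xz.
have := @ler_derive_increment R (cst 0) eta (cst 0) (fun y => (u y)^-1) x z xz.
rewrite /= subrr subr_ge0; apply.
- by move=> y /andP[xy _]; apply: eta_deriv; rewrite (le_trans x1).
- by move=> y /andP[xy _]; rewrite invr_ge0 ltW// u_gt0// (le_trans x1)// ltW.
Qed.

(** As [H <= 1] past [y1], ln u is 1-Lipschitz as a function of eta. *)
Lemma u_bound_of_increment x z c : y1 <= x -> x <= z -> eta z - eta x <= c ->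
  u z <= expR c * u x /\ u x <= expR c * u z.
Proof.
move=> x1 xz c_ge; have z1 := le_trans x1 xz.
have e0 : 0 <= eta z - eta x by rewrite subr_ge0 eta_nondecreasing.
have : `|ln (u z) - ln (u x)| <= c.
  apply: (le_trans (ln_u_increment x z x1 xz)).
  apply: (le_trans _ c_ge); rewrite ler_piMl//.
  exact: (le_trans (H_noninc y1 x (lexx _) x1)).
rewrite ler_norml => /andP[l1 l2].
by split; rewrite -ler_ln ?posrE ?mulr_gt0 ?expR_gt0 ?u_gt0// lnM ?posrE ?expR_gt0 ?u_gt0//
  expRK; lra.
Qed.

(** The ratio condition on [H], taken at the fixed index [N], gives H(y) = O(y^(-b)); with u <= k
    b_n H(b_n) this is the bound at the points [bn n], which then spreads to their neighbours. *)
Lemma u_powR_bound : exists2 C, 0 < C & forall y, y1 <= y -> u y <= C * y `^ (1 - b).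
Proof.
pose A := d * y1 `^ b * H y1.
have A0 : 0 <= A by rewrite !mulr_ge0 ?powR_ge0 ?H_ge0 ?(ltW d_gt0).
have HA y : y1 <= y -> H y <= A * y `^ (- b).
  move=> y1y; have y0 : 0 < y by exact: lt_le_trans y1_gt0 y1y.
  apply: (le_trans (H_ratio N y (leqnn N) y1y)); rewrite -/y1 /A.
  rewrite powRM ?invr_ge0 ?(ltW y0) ?(ltW y1_gt0)// -(powR_inv1 (ltW y1_gt0)) -powRrM mulN1r opprK.
  by rewrite le_eqVlt; apply/orP; left; apply/eqP; ring.
(* The 3 is the gap in [bn_step]; the summand 1 keeps [C] positive, only [0 <= A] being
   established. *)
pose C := expR 3 * (k * A) + 1.
have C0 : 0 < C by apply: ltr_wpDl => //; apply: mulr_ge0; [exact: expR_ge0|apply: mulr_ge0 => //; exact: ltW].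
have ub n : (N <= n)%N -> u (bn n) <= k * A * bn n `^ (1 - b).
  move=> Nn; have bn0 : 0 < bn n by exact: lt_le_trans y1_gt0 (bn_ge n Nn).
  apply: (le_trans (u_ratio n Nn)); rewrite -mulrA ler_pM2l//.
  rewrite powRD; last by rewrite (gt_eqF bn0) implybT.
  rewrite powRr1 ?(ltW bn0)// mulrCA ler_pM2l//; exact/HA/bn_ge.
exists C => // y y1y.
have y0 : 0 < y by exact: lt_le_trans y1_gt0 y1y.
have [n [Nn bny ybn e3]] := bn_step y y1y.
have bn1 := bn_ge n Nn; have bn2 : y1 <= bn n.+1 by exact: le_trans ybn.
have bn10 : 0 < bn n by exact: lt_le_trans bn1.
have main v : v <= k * A * y `^ (1 - b) -> u y <= expR 3 * v -> u y <= C * y `^ (1 - b).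
  move=> vle /le_trans; apply; rewrite /C mulrDl mul1r -[leLHS]addr0 lerD ?powR_ge0//.
  by rewrite -mulrA ler_pM2l ?expR_gt0.
(* The neighbour of [y] is chosen so that x^(1 - b) increases from it to [y]: the left one when b <=
   1, the right one otherwise. *)
have [b1|b1] := leP b 1.
  apply: (main (u (bn n))).
    apply: (le_trans (ub n Nn)); apply: ler_wpM2l; first exact: mulr_ge0 (ltW k_gt0) A0.
    by rewrite ge0_ler_powR ?nnegrE ?subr_ge0// ltW.
  apply: (u_bound_of_increment (bn n) y 3 bn1 bny _).1.
  by have := eta_nondecreasing y (bn n.+1) y1y ybn; lra.
apply: (main (u (bn n.+1))).
  apply: (le_trans (ub n.+1 (leqW Nn))); apply: ler_wpM2l; first exact: mulr_ge0 (ltW k_gt0) A0.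
  rewrite -opprB !powRN lef_pV2 ?posrE ?powR_gt0//; last exact: lt_le_trans ybn.
  rewrite ge0_ler_powR ?nnegrE ?subr_ge0// ?ltW//; exact: lt_le_trans ybn.
apply: (u_bound_of_increment y (bn n.+1) 3 y1y ybn _).2.
by have := eta_nondecreasing (bn n) y bn1 bny; lra.
Qed.

(* The derivative of y^b with respect to eta is b y^(b - 1) u(y), which is bounded. *)
Lemma powR_increment : exists2 C, 0 < C & forall y z, y1 <= y -> y <= z ->
  z `^ b - y `^ b <= C * (eta z - eta y).
Proof.
have [C C0 uC] := u_powR_bound.
exists (b * C) => [|y z y1y yz]; first exact: mulr_gt0.
rewrite mulrBr.
apply: (@ler_derive_increment R (fun x => x `^ b) (fun x => b * C * eta x)
  (fun x => b * x `^ (b - 1)) (fun x => b * C * (u x)^-1) y z) => // x /andP[yx xz].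
- by apply: is_derive1_powR; rewrite (lt_le_trans y1_gt0)// (le_trans y1y).
- by apply: (is_deriveZ _ (eta_deriv x _)); exact: le_trans yx.
- have y1x : y1 <= x by rewrite (le_trans y1y)// ltW.
  have x0 : 0 < x by exact: lt_le_trans y1x.
  rewrite -mulrA ler_pM2l// ler_pdivlMr ?u_gt0//.
  have := uC x y1x; rewrite -opprB powRN ler_pdivlMr ?powR_gt0//.
  by rewrite mulrC.
Qed.

(** To the right of [bn n] monotonicity is enough. To the left, the increment of x^b is divided by
    y^b >= y1^b, so the constant depends on the fixed threshold but not on [n]. *)
Lemma H_bn_bound : exists2 D, 0 < D & forall n y, (N <= n)%N -> y1 <= y ->
  H y <= D * H (bn n) * (1 + `|eta y - eta (bn n)|).
Proof.
have [C C0 pC] := powR_increment.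
pose D := 1 + d * (1 + C / y1 `^ b).
have y1b : 0 < y1 `^ b by rewrite powR_gt0.
have Cy : 0 <= C / y1 `^ b by rewrite divr_ge0 ?ltW.
have D1 : 1 <= D by rewrite lerDl mulr_ge0 ?addr_ge0 ?(ltW d_gt0).
exists D => [|n y Nn y1y]; first exact: lt_le_trans D1.
set tau := `| _ |; have tau0 : 0 <= tau by rewrite normr_ge0.
have bn1 := bn_ge n Nn.
have Hn0 := H_ge0 _ bn1.
have [bny|ybn] := leP (bn n) y.
  apply: (le_trans (H_noninc _ _ bn1 bny)).
  have : 0 <= (D - 1) * H (bn n) by rewrite mulr_ge0 ?subr_ge0.
  have : 0 <= D * H (bn n) * tau by rewrite !mulr_ge0// (le_trans _ D1).
  lra.
apply: (le_trans (H_ratio n y Nn y1y)).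
have y0 : 0 < y by exact: lt_le_trans y1y.
have bn0 : 0 < bn n by exact: lt_trans ybn.
have yb : 0 < y `^ b by rewrite powR_gt0.
have E : (y / bn n) `^ (- b) = bn n `^ b / y `^ b.
  rewrite powRM ?invr_ge0 ?ltW// -(powR_inv1 (ltW bn0)) -powRrM mulN1r opprK.
  by rewrite powRN mulrC.
rewrite E [leRHS]mulrAC ler_wpM2r//.
have y1yb : y1 `^ b <= y `^ b by rewrite ge0_ler_powR ?nnegrE ?(ltW b_gt0) ?(ltW y1_gt0) ?(ltW y0).
have bb : bn n `^ b / y `^ b <= 1 + C / y1 `^ b * tau.
  rewrite ler_pdivrMr//.
  have P := pC y (bn n) y1y (ltW ybn).
  have tE : eta (bn n) - eta y = tau.
    by rewrite /tau distrC ger0_norm// subr_ge0 eta_nondecreasing// ltW.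
  rewrite tE in P.
  have : C * tau <= C / y1 `^ b * tau * y `^ b.
    have -> : C * tau = C / y1 `^ b * tau * y1 `^ b by rewrite mulrAC divfK ?gt_eqF.
    by apply: ler_wpM2l => //; exact: mulr_ge0.
  lra.
apply: (le_trans (ler_wpM2l (ltW d_gt0) bb)).
rewrite /D; set c := C / _ in Cy *.
have : 0 <= d * (c + tau) by rewrite mulr_ge0 ?addr_ge0 ?(ltW d_gt0).
nra.
Qed.

Lemma ln_u_bound : exists2 D, 0 < D & forall n y, (N <= n)%N -> y1 <= y ->
  `|ln (u (bn n)) - ln (u y)| <=
   D * H (bn n) * (`|eta y - eta (bn n)| * (1 + `|eta y - eta (bn n)|)).
Proof.
have [D D0 HD] := H_bn_bound.
exists D => // n y Nn y1y.
have bn1 := bn_ge n Nn.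
(* The increment of ln u is governed by [H] at the left one of [y] and [bn n], so both orders reduce
   to an interval from [x] to [z]. *)
suff S x z : y1 <= x -> x <= z -> H x <= D * H (bn n) * (1 + `|eta y - eta (bn n)|) ->
    `|eta y - eta (bn n)| = eta z - eta x ->
    `|ln (u z) - ln (u x)| <=
    D * H (bn n) * (`|eta y - eta (bn n)| * (1 + `|eta y - eta (bn n)|)).
  have [yb|by_] := leP (bn n) y; last first.
    apply: S => //; rewrite ?(ltW by_)//; first exact: HD.
    by rewrite distrC ger0_norm// subr_ge0 eta_nondecreasing// ltW.
  rewrite distrC; apply: S => //.
    apply: le_trans (HD n (bn n) Nn bn1) _; rewrite subrr normr0 addr0 ler_wpM2l ?lerDl//.
    by rewrite mulr_ge0 ?H_ge0 ?(ltW D0).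
  by rewrite ger0_norm// subr_ge0 eta_nondecreasing.
move=> x1 xz Hx E; apply: (le_trans (ln_u_increment x z x1 xz)).
rewrite -E mulrC (mulrCA _ `| _ |) ler_wpM2l//.
Qed.

(** Bounding [H] by its value at the threshold loses the rate but gives a coefficient independent of
    [n] and growth that is only linear; this is what will control e^|w|. *)
Lemma ln_u_bound_linear n y : (N <= n)%N -> y1 <= y ->
  `|ln (u (bn n)) - ln (u y)| <= H y1 * `|eta y - eta (bn n)|.
Proof.
move=> Nn y1y; have bn1 := bn_ge n Nn.
have [yb|by_] := leP (bn n) y; last first.
  apply: le_trans (ln_u_increment y (bn n) y1y (ltW by_)) _.
  rewrite distrC ger0_norm ?subr_ge0 ?eta_nondecreasing ?(ltW by_)//.
  by rewrite ler_wpM2r ?subr_ge0 ?eta_nondecreasing ?(ltW by_)// H_noninc.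
rewrite distrC; apply: le_trans (ln_u_increment (bn n) y bn1 yb) _.
rewrite ger0_norm ?subr_ge0 ?eta_nondecreasing//.
by rewrite ler_wpM2r ?subr_ge0 ?eta_nondecreasing// H_noninc.
Qed.

End growth.

(** * Distribution functions with a positive density *)

(** Right continuity belongs to [cumulative]. On the left, monotone convergence over the intervals
    ending at x - 1/(n + 1) gives the integral over the open half-line, and the endpoint is a null
    set. *)
Lemma density_continuous (R : realType) (F : cumulative R R) (f : R -> R) :
  is_density F f -> continuous F.
Proof.
move=> [mf f0 Ff] x; apply/left_right_continuousP; split; last first.
  exact: cumulative_is_right_continuous.
pose s n : R := x - n.+1%:R^-1.
have sx n : s n < x by rewrite ltrBlDr ltrDl invr_gt0.
have ns : {homo s : m n / (m <= n)%N >-> m <= n}.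
  by move=> m n mn; rewrite lerD2l lerN2 lef_pV2 ?posrE// ler_nat.
have sU : \bigcup_n `]-oo, s n]%classic = `]-oo, x[%classic.
  apply/seteqP; split => y /=.
    by move=> [n _] /=; rewrite !in_itv/= => /le_lt_trans; exact.
  rewrite in_itv/= => yx.
  have xy0 : 0 < x - y by rewrite subr_gt0.
  exists (Num.truncn (x - y)^-1) => //=; rewrite in_itv/= lerBrDr -lerBrDl.
  rewrite -[leRHS]invrK lef_pV2 ?posrE ?invr_gt0//.
  by rewrite ltW// truncnS_gt// invr_ge0 ltW.
have /fine_cvgP[_] : (F (s n))%:E @[n --> \oo] --> (F x)%:E.
  under eq_fun do rewrite -Ff.
  rewrite -Ff -integral_itv_bndo_bndc; last by apply/measurable_EFinP; exact: measurable_funTS.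
  rewrite -sU; apply: ge0_nondecreasing_set_cvg_integral => //.
  - by move=> m n mn; rewrite subsetEset => y /=; rewrite !in_itv/= => /le_trans; apply; exact: ns.
  - by move=> n; apply/measurable_EFinP; exact: measurable_funTS.
  - by move=> n y _; rewrite lee_fin.
move=> /cvgrPdist_lt Fs; apply/cvgrPdist_lt => e e0.
have [n _ /(_ n (leqnn n)) /=] := Fs e e0.
rewrite ger0_norm ?subr_ge0 ?cumulative_is_nondecreasing ?ltW// => En.
near=> z.
have zx : z <= x by near: z; exact: nbhs_left_le.
rewrite ger0_norm ?subr_ge0 ?cumulative_is_nondecreasing//.
apply: le_lt_trans En; rewrite lerD2l lerN2 cumulative_is_nondecreasing//.
by near: z; exact: nbhs_left_ge.
Unshelve. all: by end_near. Qed.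

Section standing.
Variables (R : realType) (F : cumulativeBounded (0 : R) (1 : R)) (f : R -> R).
Hypothesis F_density : is_density F f.
Hypothesis F_deriv : forall x, inner F x -> is_derive x 1 (F : R -> R) (f x).
Hypothesis f_deriv : forall x, inner F x -> derivable f x 1.
Hypothesis f_gt0 : forall x, inner F x -> 0 < f x.

Let Fc : continuous F := density_continuous R F f F_density.
Let Fnd : {homo (F : R -> R) : x y / x <= y} := @cumulative_is_nondecreasing R _ _ F.

Lemma cdf_ge0 x : 0 <= F x.
Proof.
rewrite leNgt; apply/negP => Fx.
have := @cumulativeNy _ _ _ F => /cvgrPdist_lt/(_ (- F x)).
rewrite oppr_gt0 => /(_ Fx)[M [_ HM]].
have := HM (Num.min (M - 1) x); rewrite sub0r normrN => H.
have yM : Num.min (M - 1) x < M by rewrite gt_min ltrBlDr ltrDl ltr01.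
have := H yM; apply/negP; rewrite -leNgt.
have : F (Num.min (M - 1) x) <= F x by apply: Fnd; rewrite ge_min lexx orbT.
by move=> h; rewrite ler0_norm ?lerN2// (le_trans h)// ltW.
Qed.

(** By continuity [F < 1] persists slightly to the right of [x], so the supremum is strictly larger
    than [x]. *)
Lemma lt_rend x : (x%:E < rend F)%E <-> F x < 1.
Proof.
split.
  move=> /ereal_sup_gt[_ [y Fy <-]]; rewrite lte_fin => xy.
  by apply: le_lt_trans Fy; exact/Fnd/ltW.
move=> Fx; have /(cvgr_lt (F x))/(_ _ Fx) N : F y @[y --> x] --> F x by exact: Fc.
have [e /= e0 He] := N.
have Fx' : F (x + e / 2) < 1.
  by apply: He => /=; rewrite opprD addrA subrr sub0r normrN gtr0_norm ?divr_gt0// ltr_pdivrMr// ltr_pMr// ltr1n.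
apply: (@lt_le_trans _ _ (x + e / 2)%:E); first by rewrite lte_fin ltrDl divr_gt0.
by apply: ereal_sup_ubound; exists (x + e / 2).
Qed.

Lemma lt_lend x : (lend F < x%:E)%E <-> 0 < F x.
Proof.
split.
  move=> /ereal_inf_lt[_ [y Fy <-]]; rewrite lte_fin => xy.
  by apply: (lt_le_trans Fy); exact/Fnd/ltW.
move=> Fx; have /(cvgr_gt (F x))/(_ _ Fx) N : F y @[y --> x] --> F x by exact: Fc.
have [e /= e0 He] := N.
have Fx' : 0 < F (x - e / 2).
  by apply: He => /=; rewrite opprB addrC subrK gtr0_norm ?divr_gt0// ltr_pdivrMr// ltr_pMr// ltr1n.
apply: (@le_lt_trans _ _ (x - e / 2)%:E); last by rewrite lte_fin ltrBlDr ltrDl divr_gt0.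
by apply: ereal_inf_lbound; exists (x - e / 2).
Qed.

Lemma inner_cdf x : inner F x <-> 0 < F x < 1.
Proof.
split; first by move=> /andP[/lt_lend -> /lt_rend ->].
by move=> /andP[/lt_lend h1 /lt_rend h2]; apply/andP.
Qed.

Lemma near_inner x : inner F x -> \forall y \near x, inner F y.
Proof.
move=> /inner_cdf/andP[F0 F1].
have c : F y @[y --> x] --> F x by exact: Fc.
have h0 := cvgr_gt (F x) c _ F0; have h1 := cvgr_lt (F x) c _ F1.
near=> y; apply/inner_cdf/andP; split; near: y; [exact: h0|exact: h1].
Unshelve. all: by end_near. Qed.

(** If [F x] vanishes the claim is immediate; otherwise the whole of [x, y] is inner and the mean
    value theorem applies with a positive density. *)
Lemma cdf_lt x y : x < y -> inner F y -> F x < F y.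
Proof.
move=> xy iy; have /inner_cdf/andP[Fy0 Fy1] := iy.
have Fxy := Fnd _ _ (ltW xy).
have [Fx0|] := ltP 0 (F x); last by move=> /le_lt_trans; exact.
have iz z : x <= z <= y -> inner F z.
  move=> /andP[xz zy]; apply/inner_cdf/andP; split.
    exact: (lt_le_trans Fx0 (Fnd _ _ xz)).
  exact: (le_lt_trans (Fnd _ _ zy)).
have [||c] := @MVT R F f x y xy.
- by move=> z; rewrite in_itv/= => /andP[xz zy]; apply/F_deriv/iz; rewrite (ltW xz) (ltW zy).
- exact: continuous_subspaceT.
rewrite in_itv/= => /andP[xc cy] E.
have ic : inner F c by apply: iz; rewrite (ltW xc) (ltW cy).
rewrite -subr_gt0 E; apply: mulr_gt0; [exact: f_gt0|by rewrite subr_gt0].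
Qed.

(** The intermediate value theorem provides a point [z] where the value is taken; by strict
    monotonicity the set defining b_n is the open half-line from [z], whose infimum is [z]. The
    bound [1 < n] makes the value positive. *)
Lemma cdf_norm_b n : (1 < n)%N -> F (norm_b F n) = 1 - n%:R^-1.
Proof.
move=> n1; have n0 : 0 < (n%:R : R) by rewrite ltr0n ltnW.
set v := 1 - n%:R^-1.
have v0 : 0 < v by rewrite subr_gt0 invf_lt1// ltr1n.
have v1 : v < 1 by rewrite ltrBlDr ltrDl invr_gt0.
have [A FA] : exists A, F A < v.
  have := @cumulativeNy _ _ _ F => /cvgr_lt/(_ v v0)[M [_ HM]].
  by exists (M - 1); apply: HM; rewrite ltrBlDr ltrDl.
have [B FB] : exists B, v < F B.
  have := @cumulativey _ _ _ F => /cvgr_gt/(_ v v1)[M [_ HM]].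
  by exists (M + 1); apply: HM; rewrite ltrDl.
have AB : A <= B.
  by rewrite leNgt; apply/negP => /ltW/Fnd; apply/negP; rewrite -ltNge (lt_trans FA).
have [|z _ Fz] := @IVT R F A B v AB (continuous_subspaceT Fc).
  by rewrite ge_min (ltW FA)/= le_max (ltW FB) orbT.
have iz : inner F z by apply/inner_cdf; rewrite Fz v0.
suff -> : norm_b F n = z by [].
rewrite /norm_b (_ : [set x | F x > 1 - n%:R^-1] = `]z, +oo[%classic) ?inf_itv//.
apply/seteqP; split => y /=; rewrite in_itv/= andbT.
  by rewrite -/v -Fz => h; rewrite ltNge; apply/negP => /Fnd; apply/negP; rewrite -ltNge.
move=> zy; rewrite -/v ltNge; apply/negP => Fy.
have iy : inner F y.
  apply/inner_cdf/andP; split; last exact: le_lt_trans v1.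
  by apply: (lt_le_trans _ (Fnd _ _ (ltW zy))); rewrite Fz.
by have := cdf_lt z y zy iy; apply/negP; rewrite -leNgt Fz.
Qed.

Lemma inner_norm_b n : (1 < n)%N -> inner F (norm_b F n).
Proof.
move=> n1; have n0 : 0 < (n%:R : R) by rewrite ltr0n ltnW.
apply/inner_cdf; rewrite cdf_norm_b// subr_gt0 invf_lt1// ltr1n n1/=.
by rewrite ltrBlDr ltrDl invr_gt0.
Qed.

Lemma le_norm_b n x : (1 < n)%N -> F x <= 1 - n%:R^-1 -> x <= norm_b F n.
Proof.
move=> n1 Fx; rewrite leNgt; apply/negP => bx.
have Fbx := Fnd _ _ (ltW bx).
have ix : inner F x.
  have /inner_cdf/andP[b0 b1] := inner_norm_b n n1.
  apply/inner_cdf/andP; split; first exact: lt_le_trans Fbx.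
  by apply: (le_lt_trans Fx); rewrite -cdf_norm_b.
by have := cdf_lt _ _ bx ix; rewrite cdf_norm_b// ltNge Fx.
Qed.

Lemma norm_b_le n x : (1 < n)%N -> 1 - n%:R^-1 <= F x -> norm_b F n <= x.
Proof.
move=> n1 Fx; rewrite leNgt; apply/negP => xb.
by have := cdf_lt _ _ xb (inner_norm_b n n1); rewrite cdf_norm_b// ltNge Fx.
Qed.

Lemma lnF_lt0 x : inner F x -> 0 < - ln (F x).
Proof. by move=> /inner_cdf; rewrite oppr_gt0; exact: ln_lt0. Qed.

Lemma is_derive_eta x : inner F x ->
  is_derive x 1 (Defs.eta F) (f x / (F x * - ln (F x))).
Proof.
move=> ix; have /inner_cdf/andP[F0 F1] := ix; have l0 := lnF_lt0 x ix.
have d1 := is_deriveN (@is_derive1_comp R (@ln R) F x _ _ (is_derive1_ln F0) (F_deriv x ix)).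
have d2 := is_deriveN (@is_derive1_comp R (@ln R) _ x _ _ (is_derive1_ln l0) d1).
have -> : f x / (F x * - ln (F x)) = - ((- ln (F x))^-1 * - ((F x)^-1 * f x)).
  by set L := - ln _; rewrite (mulrN L^-1) opprK invfM mulrA mulrC [f x * _]mulrC.
exact: d2.
Qed.

Lemma aux_uE x : inner F x -> aux_u F x = F x * (- ln (F x)) / f x.
Proof.
move=> ix; rewrite /aux_u derive1E (@derive_val _ _ _ _ _ _ _ (is_derive_eta x ix)).
by rewrite invf_div.
Qed.

Lemma aux_u_gt0 x : inner F x -> 0 < aux_u F x.
Proof.
move=> ix; rewrite aux_uE// divr_gt0 ?f_gt0// mulr_gt0 ?lnF_lt0//.
by have /inner_cdf/andP[] := ix.
Qed.

Lemma is_derive_eta_aux_u x : inner F x -> is_derive x 1 (Defs.eta F) (aux_u F x)^-1.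
Proof. by move=> ix; rewrite aux_uE// invf_div; exact: is_derive_eta. Qed.

Lemma is_derive_aux_u x : inner F x -> is_derive x 1 (aux_u F) (aux_u' F x).
Proof.
move=> ix; rewrite /aux_u' derive1E; apply: derivableP.
have /inner_cdf/andP[F0 F1] := ix.
(* The closed formula for [aux_u] holds at inner points only; these form an open set, so it holds
   near [x]. *)
apply: (@near_eq_derivable _ _ _ (fun x => F x * (- ln (F x)) * (f x)^-1)).
  by near=> y; rewrite aux_uE//; near: y; exact: near_inner.
have dF : derivable F x 1 by have [] := F_deriv x ix.
apply: derivableM.
  apply: derivableM => //; apply: derivableN.
  by have [] := @is_derive1_comp R (@ln R) F x _ _ (is_derive1_ln F0) (F_deriv x ix).
apply: derivableV; last exact: f_deriv.
by rewrite gt_eqF ?f_gt0.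
Unshelve. all: by end_near. Qed.

End standing.

(** * The ratio conditions *)

Lemma aux_h_ge (R : realType) (F : R -> R) x y : x < y -> (y%:E < rend F)%E ->
  (`|aux_u' F y|%:E <= aux_h F x)%E.
Proof. by move=> xy yr; apply: ereal_sup_ubound; exists y. Qed.

Lemma aux_h_le (R : realType) (F : R -> R) x (c : \bar R) :
  (forall y, x < y -> (y%:E < rend F)%E -> (`|aux_u' F y|%:E <= c)%E) ->
  (aux_h F x <= c)%E.
Proof. by move=> H; apply: ge_ereal_sup => _ [y [xy yr] <-]; exact: H. Qed.

Lemma aux_h_noninc (R : realType) (F : R -> R) x y : x <= y -> (aux_h F y <= aux_h F x)%E.
Proof.
by move=> xy; apply: aux_h_le => z yz zr; apply: aux_h_ge => //; exact: le_lt_trans yz.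
Qed.

(** A supremum over the empty set would be -oo; a midpoint below the right endpoint shows that the
    set is inhabited. *)
Lemma aux_h_ge0 (R : realType) (F : R -> R) x : (x%:E < rend F)%E -> (0 <= aux_h F x)%E.
Proof.
move=> /ereal_sup_gt[_ [y Fy <-]]; rewrite lte_fin => xy.
have [m1 m2] := midf_lt xy.
apply: (@le_trans _ _ (`|aux_u' F ((x + y) / 2)|%:E)%E); first by rewrite lee_fin.
apply: aux_h_ge => //.
apply: (@lt_le_trans _ _ y%:E); first by rewrite lte_fin.
by apply: ereal_sup_ubound; exists y.
Qed.

Lemma aux_h_cvg0 (R : realType) (F : R -> R) (e : R) : 0 < e ->
  aux_u' F x @[x --> at_left_ereal (rend F)] --> 0 ->
  exists2 x0 : R, (x0%:E < rend F)%E & (aux_h F x0 <= e%:E)%E.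
Proof.
move=> e0 /(_ (ball (0 : R) e) (nbhsx_ballx _ _ e0))[x0 /= x0r sub].
exists x0 => //; apply: aux_h_le => y x0y yr; rewrite lee_fin; apply: ltW.
have := sub y (conj x0y yr). by rewrite /= /ball/= sub0r normrN.
Qed.

(** * The right endpoint and the position of b_n *)

Section ratio.
Variables (R : realType) (F : cumulativeBounded (0 : R) (1 : R)) (f : R -> R).
Hypothesis F_density : is_density F f.
Hypothesis F_deriv : forall x, inner F x -> is_derive x 1 (F : R -> R) (f x).
Hypothesis f_deriv : forall x, inner F x -> derivable f x 1.
Hypothesis f_gt0 : forall x, inner F x -> 0 < f x.
Hypothesis u'_cvg0 : aux_u' F x @[x --> at_left_ereal (rend F)] --> 0.
Variables (k : R) (n0 : nat).
Hypothesis k_gt0 : 0 < k.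
Hypothesis ratio_le : forall n, (n0 <= n)%N ->
     ((aux_u F (norm_b F n))%:E / ((norm_b F n)%:E * aux_h F (norm_b F n))
        <= k%:E)%E.
Variables (b d : R).
Hypothesis b_gt0 : 0 < b.
Hypothesis d_gt0 : 0 < d.
Hypothesis h_ratio_le : forall (c : R) (n : nat), c < k^-1 -> (n0 <= n)%N ->
     inner F (norm_b F n * (1 - c * k)) ->
     (aux_h F (norm_b F n * (1 - c * k)) / aux_h F (norm_b F n)
        <= (d * (1 - c * k) `^ (- b))%:E)%E.

Let Fnd : {homo (F : R -> R) : x y / x <= y} := @cumulative_is_nondecreasing R _ _ F.
Let Einner := inner_cdf R F f F_density.
Let Erend := lt_rend R F f F_density.
Let ib := inner_norm_b R F f F_density F_deriv f_gt0.
Let Fb := cdf_norm_b R F f F_density F_deriv f_gt0.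
Let u0 := aux_u_gt0 R F f F_density F_deriv f_gt0.

(* In \bar R the inverse of 0 is +oo, so the upper bound on the ratio excludes 0. *)
Lemma norm_b_aux_h_neq0 n : (1 < n)%N -> (n0 <= n)%N ->
  ((norm_b F n)%:E * aux_h F (norm_b F n) != 0)%E.
Proof.
move=> n1 n0n; apply/eqP => E; have := ratio_le n n0n.
by rewrite E inve0 gt0_muley ?lte_fin ?u0//; exact: ib.
Qed.

Lemma norm_b_neq0 n : (1 < n)%N -> (n0 <= n)%N -> norm_b F n != 0.
Proof.
move=> n1 n0n; apply: contra (norm_b_aux_h_neq0 n n1 n0n) => /eqP E.
by rewrite [X in (X%:E * _)%E]E mul0e.
Qed.

Lemma aux_h_gt0 n : (1 < n)%N -> (n0 <= n)%N -> (0 < aux_h F (norm_b F n))%E.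
Proof.
move=> n1 n0n; rewrite lt_def aux_h_ge0 ?andbT.
  by apply: contra (norm_b_aux_h_neq0 n n1 n0n) => /eqP ->; rewrite mule0.
by have /andP[] := ib n n1.
Qed.

Lemma norm_b_ge x : F x < 1 ->
  exists N, forall n, (N <= n)%N -> (1 < n)%N /\ x <= norm_b F n.
Proof.
move=> Fx; have Fx0 : 0 < 1 - F x by rewrite subr_gt0.
exists (maxn 2 (Num.truncn (1 - F x)^-1).+1) => n; rewrite geq_max => /andP[n1 Nn].
have n_gt0 : 0 < (n%:R : R) by rewrite ltr0n ltnW.
split => //; apply: (le_norm_b R F f F_density F_deriv f_gt0) => //.
rewrite lerBrDr -lerBrDl -[leRHS]invrK lef_pV2 ?posrE ?invr_gt0//.
apply: ltW; apply: (lt_le_trans (truncnS_gt _)); by rewrite ler_nat.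
Qed.

(** The choice c = (1 - x / b_n) / k makes b_n (1 - c k) equal to [x], and c < 1 / k says exactly
    that x / b_n > 0. Finiteness of h(b_n) allows the quotient to be cleared. *)
Lemma aux_h_ratio n x : (1 < n)%N -> (n0 <= n)%N -> inner F x ->
  0 < x / norm_b F n -> (aux_h F (norm_b F n) < +oo)%E ->
  (aux_h F x <= (d * (x / norm_b F n) `^ (- b))%:E * aux_h F (norm_b F n))%E.
Proof.
move=> n1 n0n ix s0 hfin.
have h0 := aux_h_gt0 n n1 n0n.
have bn0 := norm_b_neq0 n n1 n0n.
have := h_ratio_le ((1 - x / norm_b F n) / k) n.
have -> : 1 - (1 - x / norm_b F n) / k * k = x / norm_b F n.
  by rewrite divfK ?gt_eqF// opprB addrC subrK.
rewrite (mulrC (norm_b F n)) divfK//.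
rewrite ltr_pdivrMr// mulVf ?gt_eqF// ltrBlDr ltrDl => /(_ s0 n0n ix).
case: (aux_h F (norm_b F n)) h0 hfin => [r| |]// r0 _.
by rewrite inver gt_eqF// lee_pdivrMr.
Qed.

Lemma aux_h_norm_b_le (e : R) : 0 < e ->
  exists N, forall n, (N <= n)%N -> (aux_h F (norm_b F n) <= e%:E)%E.
Proof.
move=> e0; have [x0 /Erend x0r hx0] := aux_h_cvg0 R F e e0 u'_cvg0.
have [N HN] := norm_b_ge x0 x0r; exists N => n /HN[_ x0b].
exact: le_trans (aux_h_noninc _ _ _ _ x0b) hx0.
Qed.

(* With a finite right endpoint, h(z) <= K h(b_n) for some fixed z = b_m and all large n,
   whereas h(b_n) tends to 0 and h(z) > 0. *)
Lemma cdf_lt1 x : F x < 1.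
Proof.
rewrite ltNge; apply/negP => Fx1.
have bx n : (1 < n)%N -> norm_b F n < x.
  move=> n1; rewrite ltNge; apply/negP => /Fnd; apply/negP; rewrite -ltNge.
  by apply: lt_le_trans Fx1; have /Einner/andP[] := ib n n1.
suff [z [N [K [K0 [n1 [n11 n0n1 zE]] HK]]]] : exists z N K, [/\ 0 < K,
    (exists n, [/\ (1 < n)%N, (n0 <= n)%N & z = norm_b F n])
    & forall n, (N <= n)%N -> 0 < z / norm_b F n /\ d * (z / norm_b F n) `^ (- b) <= K].
  have iz : inner F z by rewrite zE; exact: ib.
  have hz : (0 < aux_h F z)%E by rewrite zE; exact: aux_h_gt0.
  have hle (e : R) : 0 < e -> (aux_h F z <= (K * e)%:E)%E.
    move=> e0; have [N' HN'] := aux_h_norm_b_le e e0.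
    pose n := maxn (maxn N N') (maxn 2 n0).
    have [Nn N'n] : (N <= n)%N /\ (N' <= n)%N by rewrite /n !leq_max !leqnn ?orbT.
    have [n2 n0n] : (1 < n)%N /\ (n0 <= n)%N.
      by rewrite /n; split; rewrite !leq_max ?leqnn ?ltnSn ?orbT.
    have [s0 sK] := HK n Nn; have he := HN' n N'n.
    apply: (le_trans (aux_h_ratio n z n2 n0n iz s0 (le_lt_trans he (ltry _)))).
    rewrite [leRHS]EFinM; apply: lee_pmul => //.
      by rewrite lee_fin mulr_ge0 ?powR_ge0 ?(ltW d_gt0).
    by rewrite ltW// aux_h_gt0.
  move: hz hle; case: (aux_h F z) => [r| |] //.
    rewrite lte_fin => r0 /(_ (r / (2 * K))); rewrite divr_gt0 ?mulr_gt0// => /(_ isT).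
    rewrite lee_fin leNgt => /negP; apply.
    have -> : K * (r / (2 * K)) = r / 2 by field; rewrite gt_eqF.
    by rewrite ltr_pdivrMr// ltr_pMr// ltr1n.
  by move=> _ /(_ 1 ltr01).
(* The ratio z / b_n has to stay away from 0. If [F 0 < 1], then b_n > 0 for large n, and b_n < x
   gives z / b_n >= z / x. *)
have [F01|F01] := ltP (F 0) 1.
  have [N HN] := norm_b_ge 0 F01.
  pose N1 := maxn N n0.
  have bN n : (N1 <= n)%N -> [/\ (1 < n)%N, (n0 <= n)%N & 0 < norm_b F n].
    rewrite geq_max => /andP[/HN[n1 bn0] n0n]; split => //.
    by rewrite lt_def bn0 norm_b_neq0.
  have [N11 n0N1 bN0] := bN N1 (leqnn _).
  have x0 : 0 < x by exact: lt_trans bN0 (bx _ N11).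
  exists (norm_b F N1), N1, (d * (norm_b F N1 / x) `^ (- b)); split.
  - by rewrite mulr_gt0// powR_gt0// divr_gt0.
  - by exists N1.
  - move=> n /bN[n1 _ bn0]; split; first exact: divr_gt0.
    rewrite ler_pM2l// !powRN lef_pV2 ?posrE ?powR_gt0 ?divr_gt0//.
    rewrite ge0_ler_powR ?nnegrE ?divr_ge0 ?(ltW b_gt0) ?(ltW bN0) ?(ltW x0) ?(ltW bn0)//.
    by rewrite ler_pM2l// lef_pV2 ?posrE// ltW// bx.
(* Otherwise every b_n is negative and nondecreasing in n, so the ratio of b_N1 to b_n is at least 1
   and [K = d] works. *)
have bneg n : (1 < n)%N -> norm_b F n < 0.
  move=> n1; rewrite ltNge; apply/negP => /Fnd; apply/negP; rewrite -ltNge.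
  by apply: lt_le_trans F01; have /Einner/andP[] := ib n n1.
pose N1 := maxn 2 n0.
have [N11 n0N1] : (1 < N1)%N /\ (n0 <= N1)%N by rewrite /N1; split; rewrite leq_max ?leqnn ?orbT.
exists (norm_b F N1), N1, d; split => //; first by exists N1.
move=> n Nn; have n1 : (1 < n)%N by exact: leq_trans Nn.
have s0 : 0 < norm_b F N1 / norm_b F n by rewrite ltr_ndivlMr ?bneg// mul0r bneg.
split => //; rewrite ler_piMr ?(ltW d_gt0)// powRN invf_le1 ?powR_gt0//.
have E1 : 1 = 1 `^ b :> R by rewrite powR1.
rewrite [leLHS]E1 ge0_ler_powR ?nnegrE ?(ltW b_gt0) ?(ltW s0)//.
rewrite ler_ndivlMr ?bneg// mul1r.
apply: (le_norm_b R F f F_density F_deriv f_gt0) => //; rewrite Fb//.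
by rewrite lerD2l lerN2 lef_pV2 ?posrE ?ltr0n ?(ltnW n1) ?(ltnW N11)// ler_nat.
Qed.

Lemma rend_gt x : (x%:E < rend F)%E.
Proof. exact/Erend/cdf_lt1. Qed.

(** The number p = - ln (1 - 1/n) lies between 1/n and 2/n, so - ln p is within ln 2 <= 1 of ln
    n. *)
Lemma eta_norm_b n : (1 < n)%N -> `|Defs.eta F (norm_b F n) - ln n%:R| <= 1.
Proof.
move=> n1; have n_gt0 : 0 < (n%:R : R) by rewrite ltr0n ltnW.
have n2 : 2 <= (n%:R : R) by rewrite ler_nat.
rewrite /Defs.eta Fb//.
set p := - ln (1 - _).
have v0 : 0 < 1 - (n%:R : R)^-1 by rewrite subr_gt0 invf_lt1// ltr1n.
have p1 : n%:R^-1 <= p.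
  by have := @le_ln1Dx R (- n%:R^-1); rewrite ltrN2 invf_lt1// ltr1n => /(_ n1); rewrite /p; lra.
have p2 : p <= 2 * n%:R^-1.
  rewrite /p -lnV ?posrE//.
  have -> : (1 - (n%:R : R)^-1)^-1 = 1 + (n%:R - 1)^-1.
    by field; rewrite !gt_eqF//; lra.
  have m0 : 0 < (n%:R - 1 : R) by lra.
  apply: (le_trans (le_ln1Dx _)); first by apply: (lt_trans _ (_ : 0 < _)); rewrite ?oppr_lt0 ?invr_gt0.
  by rewrite -[leLHS]mul1r ler_pdivrMr// mulrAC ler_pdivlMr//; lra.
have p0 : 0 < p by apply: lt_le_trans p1; rewrite invr_gt0.
have l1 : - ln n%:R <= ln p by rewrite -lnV ?posrE// ler_ln ?posrE ?invr_gt0.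
have l2 : ln p <= ln 2 - ln n%:R.
  by rewrite -ln_div ?posrE// ler_ln ?posrE ?divr_gt0.
have l3 : ln (2 : R) <= 1.
  by have := @le_ln1Dx R 1; rewrite (_ : 1 + 1 = 2 :> R)//; apply; lra.
by rewrite ler_norml; apply/andP; split; lra.
Qed.

End ratio.

(** * Perturbation of the Gumbel integral *)

Lemma ler_norm_expR_sub1 (R : realType) (w : R) : `|expR w - 1| <= `|w| * expR `|w|.
Proof.
have [w0|w0] := leP 0 w.
  rewrite (ger0_norm w0) ger0_norm; last by rewrite subr_ge0 -expR0 ler_expR.
  have h := expR_ge1Dx (- w).
  have : (1 - w) * expR w <= expR (- w) * expR w by rewrite ler_wpM2r ?expR_ge0.
  rewrite -expRD addNr expR0.
  lra.
rewrite (ltr0_norm w0) ler0_norm; last by rewrite subr_le0 -[leRHS]expR0 ler_expR ltW.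
have h := expR_ge1Dx w; have h' := expR_ge1Dx (- w).
have : 0 <= - w * (expR (- w) - 1) by rewrite mulr_ge0//; lra.
lra.
Qed.

(** Each one-sided difference of logarithms is bounded by ln x - ln y <= (x - y) / y, and E <= J / 2
    keeps both denominators at least J / 2. *)
Lemma ler_dist_ln (R : realType) (I J E : R) : 0 < J -> `|I - J| <= E -> E <= J / 2 ->
  `|ln I - ln J| <= 2 / J * E.
Proof.
move=> J0; rewrite ler_norml => /andP[l1 l2] EJ.
have I0 : 0 < I by lra.
have E0 : 0 <= E by lra.
have ln_le (x y : R) : 0 < x -> 0 < y -> ln x - ln y <= (x - y) / y.
  move=> x0 y0; rewrite -ln_div ?posrE//.
  have -> : x / y = 1 + (x - y) / y by field; rewrite gt_eqF.
  apply: le_ln1Dx; rewrite ltr_pdivlMr// mulN1r; lra.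
have h1 := ln_le I J I0 J0; have h2 := ln_le J I J0 I0.
have k1 : (I - J) / J <= 2 / J * E.
  by rewrite mulrAC ler_pM2r ?invr_gt0//; lra.
have k2 : (J - I) / I <= 2 / J * E.
  rewrite ler_pdivrMr//; apply: (@le_trans _ _ E); first lra.
  rewrite mulrAC ler_peMl// mulrAC ler_pdivlMr// mul1r; lra.
by rewrite ler_norml; apply/andP; split; lra.
Qed.

(** Half of the exponent K n, with K = - ln q, pays for sqrt n by completing a square, and half for
    p ln n through ln (s n) <= s n with s = K / (2 p). The summand K in the constant comes from the
    exponent n - 1. *)
Lemma powR_expn_le (R : realType) (p q : R) : 0 < p -> 0 < q < 1 ->
  exists2 C, 0 < C & forall n : nat, (0 < n)%N ->
    n%:R `^ p * q ^+ n.-1 <= C * (n%:R * expR (- Num.sqrt n%:R)).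
Proof.
move=> p0 /andP[q0 q1].
pose K := - ln q; have K0 : 0 < K by rewrite oppr_gt0 ln_lt0// q0.
pose s := K / (2 * p); have s0 : 0 < s by rewrite divr_gt0// mulr_gt0.
exists (expR (K + (2 * K)^-1 - p * ln s)) => [|n n_gt0]; first exact: expR_gt0.
have n0 : 0 < (n%:R : R) by rewrite ltr0n.
have n1 : 1 <= (n%:R : R) by rewrite ler1n.
have -> : q ^+ n.-1 = expR (- (K * (n%:R - 1))).
  have -> : n%:R - 1 = n.-1%:R :> R by rewrite -subn1 natrB.
  by rewrite /K mulNr opprK mulrC expRM_natl lnK.
have -> : (n%:R : R) `^ p = expR (p * ln n%:R) by rewrite /powR gt_eqF.
rewrite mulrCA -[leLHS]mul1r ler_pM ?mulr_ge0 ?expR_ge0// -!expRD ler_expR.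
have h1 : Num.sqrt n%:R <= K * n%:R / 2 + (2 * K)^-1.
  set r := Num.sqrt _.
  have rr : n%:R = r ^+ 2 by rewrite sqr_sqrtr// ltW.
  rewrite rr; have := sqr_ge0 (K * r - 1).
  have -> : K * r ^+ 2 / 2 + (2 * K)^-1 = (K * r - 1) ^+ 2 / (2 * K) + r.
    by field; rewrite gt_eqF.
  move=> h; rewrite lerDr divr_ge0// mulr_ge0// ltW//.
have h2 : p * ln n%:R <= K * n%:R / 2 - p * ln s.
  have : ln (s * n%:R) <= s * n%:R by rewrite ltW// ln_sublinear// mulr_gt0.
  rewrite lnM ?posrE// -(ler_pM2l p0) mulrDr.
  have -> : p * (s * n%:R) = K * n%:R / 2 by rewrite /s; field; rewrite gt_eqF.
  lra.
lra.
Qed.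

(** With r = sqrt n, the bound (r / 4)^4 <= e^r suffices, and 256 = 4^4. It makes explicit how large
    n has to be for this error term to be small. *)
Lemma natr_expR_sqrt_le (R : realType) (n : nat) : (0 < n)%N ->
  n%:R * expR (- Num.sqrt n%:R) <= 256 / n%:R :> R.
Proof.
move=> n_gt0; have n0 : 0 < (n%:R : R) by rewrite ltr0n.
set r := Num.sqrt _; have rr : n%:R = r ^+ 2 by rewrite sqr_sqrtr// ltW.
have r0 : 0 < r by rewrite sqrtr_gt0.
have h : r / 4 <= expR (r / 4) by have := expR_ge1Dx (r / 4); lra.
have : (r / 4) ^+ 4 <= expR r.
  have -> : expR r = expR (r / 4) ^+ 4 by rewrite -expRM_natl; congr expR; lra.
  by rewrite lerXn2r ?nnegrE ?expR_ge0 ?divr_ge0 ?(ltW r0).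
move=> h4; rewrite ler_pdivlMr// expRN mulrAC ler_pdivrMr ?expR_gt0// rr.
by move: h4; rewrite expr_div_n ler_pdivrMr; lra.
Qed.

(** In |w| e^|w| the quadratic bound gives the small factor [M] and costs e^(tau / 4), and the
    linear bound costs another e^(tau / 4). The total e^(tau / 2) is absorbed by passing from psi to
    psi / 2. *)
Lemma gumbel_perturbation (R : realType) (beta psi tau w M : R) : 1 <= beta ->
  0 <= tau -> tau <= `|psi| + 1 -> 0 <= M ->
  `|w| <= M * (tau * (1 + tau)) -> `|w| <= tau / 4 ->
  `|gumbel_pdf psi `^ beta * expR w - gumbel_pdf psi `^ beta| <=
    64 * expR 2 * M * gumbel_pdf (psi / 2).
Proof.
move=> b1 t0 tp M0 w1 w2.
rewrite -[X in _ - X]mulr1 -mulrBr normrM ger0_norm ?powR_ge0//.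
have e4 : 1 + tau <= 4 * expR (tau / 4) by have := expR_ge1Dx (tau / 4); lra.
(* Squaring 1 + tau / 8 <= e^(tau / 8) gives the quadratic term tau^2 / 64, hence the constant. *)
have e8 : tau * (1 + tau) <= 64 * expR (tau / 4).
  have := expR_ge1Dx (tau / 8).
  have -> : expR (tau / 4) = expR (tau / 8) ^+ 2.
    by rewrite -expRM_natl; congr expR; lra.
  set v := expR _ => h; have : (1 + tau / 8) ^+ 2 <= v ^+ 2.
    by rewrite lerXn2r ?nnegrE ?expR_ge0//; lra.
  lra.
have wle : `|expR w - 1| <= 64 * M * expR (tau / 2).
  apply: (le_trans (ler_norm_expR_sub1 _ _)).
  have -> : expR (tau / 2) = expR (tau / 4) * expR (tau / 4).
    by rewrite -expRD; congr expR; lra.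
  rewrite mulrA ler_pM ?expR_ge0 ?ler_expR//.
  apply: (le_trans w1); rewrite (mulrC 64) -mulrA ler_wpM2l//.
apply: (@le_trans _ _ (gumbel_pdf psi * (64 * M * expR ((`|psi| + 1) / 2)))).
  apply: ler_pM; rewrite ?powR_ge0 ?powR_gumbel_pdf_le//.
  apply: (le_trans wle); rewrite ler_wpM2l ?mulr_ge0// ler_expR; lra.
rewrite mulrCA [64 * expR 2 * M]mulrAC -[leRHS]mulrA ler_wpM2l ?mulr_ge0//.
exact: gumbel_pdf_expR_le.
Qed.

(** * Comparison of integrals in the variable psi *)

Section comparison.
Variables (R : realType) (beta : R).
Hypothesis beta_gt1 : 1 < beta.
Local Notation mu := (@lebesgue_measure R).

Lemma continuous_powR_gumbel_pdf : continuous (fun x : R => gumbel_pdf x `^ beta).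
Proof.
move=> x; rewrite /powR.
have -> : (fun x : R => gumbel_pdf x `^ beta) = (fun x : R => expR (beta * (- x - expR (- x)))).
  apply/funext => y; rewrite /powR gt_eqF ?gumbel_pdf_gt0//.
  by rewrite gumbel_pdfE expRK.
apply: differentiable_continuous; apply/derivable1_diffP.
by [].
Qed.

Lemma integral_powR_gumbel_pdf_fin :
  (\int[mu]_x (@gumbel_pdf R x `^ beta)%:E)%E \is a fin_num.
Proof.
have m : measurable_fun [set: R] (fun x : R => gumbel_pdf x `^ beta).
  by apply: continuous_measurable_fun; exact: continuous_powR_gumbel_pdf.
rewrite ge0_fin_numE; last by apply: integral_ge0 => x _; rewrite lee_fin powR_ge0.
apply: (@le_lt_trans _ _ 1%E); last exact: ltry.
rewrite -(integral_gumbel_pdf R); apply: ge0_le_integral => //=.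
- by move=> x _; rewrite lee_fin powR_ge0.
- exact/measurable_EFinP.
- apply/measurable_EFinP; apply: continuous_measurable_fun.
  exact: continuous_gumbel_pdf.
- by move=> x _; rewrite lee_fin powR_gumbel_pdf_le// ltW.
Qed.

Lemma integral_powR_gumbel_pdf_gt0 :
  (0 < \int[mu]_x (@gumbel_pdf R x `^ beta)%:E)%E.
Proof.
have m : measurable_fun [set: R] (fun x : R => gumbel_pdf x `^ beta).
  by apply: continuous_measurable_fun; exact: continuous_powR_gumbel_pdf.
(* On [0, 1] the exponent -x - e^(-x) of the density is at least -1 - e^0. *)
pose c := (expR (-1 - expR 0) : R) `^ beta.
apply: (@lt_le_trans _ _ (\int[mu]_(x in `[0%R, 1%R]) c%:E)%E).
  rewrite integral_cst//= lebesgue_measure_itv/= lte_fin ltr01 oppr0 adde0 mule1.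
  by rewrite lte_fin powR_gt0 ?expR_gt0.
apply: (@le_trans _ _ (\int[mu]_(x in `[0%R, 1%R]) (gumbel_pdf x `^ beta)%:E)%E).
  apply: ge0_le_integral => //=.
  - by move=> x _; rewrite lee_fin powR_ge0.
  - by apply/measurable_EFinP; exact: measurable_funTS.
  - move=> x; rewrite in_itv/= => /andP[x0 x1]; rewrite lee_fin.
    apply: ge0_ler_powR; rewrite ?nnegrE ?expR_ge0 ?(ltW (gumbel_pdf_gt0 _ _))//.
      by rewrite (le_trans ler01)// ltW.
    rewrite gumbel_pdfE ler_expR.
    have : expR (- x) <= expR 0 by rewrite ler_expR; lra.
    by lra.
apply: ge0_subset_integral => //=.
  exact/measurable_EFinP.
by move=> x _; rewrite lee_fin powR_ge0.
Qed.

Lemma ge0_le_integralD (D : set R) (A L K : R -> R) : measurable D ->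
  measurable_fun D A -> measurable_fun D L -> measurable_fun D K ->
  (forall x, D x -> 0 <= A x) -> (forall x, D x -> 0 <= L x) ->
  (forall x, D x -> 0 <= K x) -> (forall x, D x -> A x <= L x + K x) ->
  (\int[mu]_(x in D) (A x)%:E <=
   \int[mu]_(x in D) (L x)%:E + \int[mu]_(x in D) (K x)%:E)%E.
Proof.
move=> mD mA mL mK A0 L0 K0 le.
rewrite -ge0_integralD//=; [|exact/measurable_EFinP|exact/measurable_EFinP].
apply: ge0_le_integral => //=.
- exact/measurable_EFinP.
- by apply/measurable_EFinP; exact: measurable_funD.
Qed.

(** Both inequalities are in additive form, so that nothing is subtracted in [\bar R] before the
    integral of [A] is known to be finite. *)
Lemma integral_gumbel_comparison (psi dpsi A : R -> R) (y1 c : R) :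
  (forall y, y1 <= y -> is_derive y 1 psi (dpsi y)) ->
  (forall y, y1 <= y -> 0 < dpsi y) ->
  (forall y, y1 <= y -> {for y, continuous dpsi}) ->
  psi y @[y --> +oo] --> +oo ->
  measurable_fun [set: R] A -> (forall y, 0 <= A y) -> 0 <= c ->
  (forall y, y1 <= y -> `|A y - gumbel_pdf (psi y) `^ beta * dpsi y| <=
     c * (gumbel_pdf (psi y / 2) * dpsi y)) ->
  (\int[mu]_(y in `[y1, +oo[) (A y)%:E <=
     \int[mu]_x (gumbel_pdf x `^ beta)%:E + (2 * c)%:E)%E /\
  (\int[mu]_x (gumbel_pdf x `^ beta)%:E <=
     \int[mu]_(y in `[y1, +oo[) (A y)%:E + (2 * c + gumbel_cdf (psi y1))%:E)%E.
Proof.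
move=> dP P0 cP Py mA A0 c0 le.
have D0 y : `[y1, +oo[%classic y -> y1 <= y by rewrite /= in_itv/= andbT.
have ml : measurable_fun [set: R] (fun x : R => gumbel_pdf x `^ beta).
  by apply: continuous_measurable_fun; exact: continuous_powR_gumbel_pdf.
have cpsi y : y1 <= y -> {for y, continuous psi}.
  move=> yy; apply: differentiable_continuous; apply/derivable1_diffP.
  by have [] := dP y yy.
have mc (G : R -> R) (a : R) : continuous G ->
    measurable_fun `[y1, +oo[%classic (fun y => G (psi y * a) * dpsi y).
  move=> cG; apply: subspace_continuous_measurable_fun => //.
  apply: continuous_in_subspaceT => y /set_mem/D0 yy.
  apply: continuousM; last exact: cP.
  apply: continuous_comp; last exact: cG.
  apply: continuousM; [exact: cpsi|exact: cst_continuous].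
have mL : measurable_fun `[y1, +oo[%classic (fun y => gumbel_pdf (psi y) `^ beta * dpsi y).
  apply: (eq_measurable_fun (fun y => gumbel_pdf (psi y * 1) `^ beta * dpsi y)).
    by move=> y _; rewrite mulr1.
  exact: mc (fun x => gumbel_pdf x `^ beta) 1 continuous_powR_gumbel_pdf.
have mK : measurable_fun `[y1, +oo[%classic (fun y => c * (gumbel_pdf (psi y / 2) * dpsi y)).
  apply: measurable_funM; first exact: measurable_cst.
  exact: mc (@gumbel_pdf R) 2^-1 (@continuous_gumbel_pdf R).
have mAD : measurable_fun `[y1, +oo[%classic A by exact: measurable_funTS.
have EL : (\int[mu]_(y in `[y1, +oo[) (gumbel_pdf (psi y) `^ beta * dpsi y)%:E =
    \int[mu]_(x in `[psi y1, +oo[) (gumbel_pdf x `^ beta)%:E)%E.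
  rewrite (ge0_integral_substitution_y R psi dpsi (fun x => gumbel_pdf x `^ beta) y1)//.
    exact: continuous_powR_gumbel_pdf.
  by move=> x; exact: powR_ge0.
(* In the variable psi / 2 the weight is the Gumbel density itself, of mass at most 1; the factor 2
   is the Jacobian. *)
have EK : (\int[mu]_(y in `[y1, +oo[) (c * (gumbel_pdf (psi y / 2) * dpsi y))%:E <=
    (2 * c)%:E)%E.
  have -> : (\int[mu]_(y in `[y1, +oo[) (c * (gumbel_pdf (psi y / 2) * dpsi y))%:E =
     (2 * c)%:E * \int[mu]_(y in `[y1, +oo[) (gumbel_pdf (psi y / 2) * (dpsi y / 2))%:E)%E.
    rewrite -ge0_integralZl//=; last 3 first.
    - apply/measurable_EFinP.
      apply: (eq_measurable_fun (fun y => (gumbel_pdf (psi y / 2) * dpsi y) * 2^-1)).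
        by move=> y _; rewrite mulrA.
      apply: measurable_funM; last exact: measurable_cst.
      exact: mc (@gumbel_pdf R) 2^-1 (@continuous_gumbel_pdf R).
    - move=> y /D0 yy; rewrite lee_fin mulr_ge0 ?divr_ge0 ?ltW ?gumbel_pdf_gt0 ?P0//.
    - by rewrite lee_fin mulr_ge0.
    by apply: eq_integral => y _; rewrite -EFinM; congr EFin; field.
  rewrite [X in (_ * X)%E](_ : _ = \int[mu]_(x in `[(psi y1 / 2)%R, +oo[) (gumbel_pdf x)%:E)%E.
    rewrite integral_gumbel_pdf_y -EFinB -EFinM lee_fin ler_piMr ?mulr_ge0//.
    by have := gumbel_cdf_gt0 R (psi y1 / 2); lra.
  apply/esym; apply: (ge0_integral_substitution_y R (fun y => psi y / 2)
    (fun y => dpsi y / 2) (@gumbel_pdf R) y1).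
  - move=> y yy; have h := dP y yy.
    have -> : (fun y => psi y / 2) = (2^-1 : R) \*: psi.
      by apply/funext => z /=; rewrite mulrC.
    by rewrite mulrC; exact: is_deriveZ.
  - by move=> y yy; rewrite divr_gt0// P0.
  - by move=> y yy; apply: continuousM; [exact: cP|exact: cst_continuous].
  - apply/cvgryPge => M; move/cvgryPge : Py => /(_ (M * 2)).
    by apply: filterS => y; rewrite ler_pdivlMr.
  - exact: continuous_gumbel_pdf.
  - by move=> x; exact/ltW/gumbel_pdf_gt0.
have le1 := ge0_le_integralD `[y1, +oo[%classic A _ _ (measurable_itv _) mAD mL mK.
have le2 := ge0_le_integralD `[y1, +oo[%classic _ A _ (measurable_itv _) mL mAD mK.
have K0 y : `[y1, +oo[%classic y -> 0 <= c * (gumbel_pdf (psi y / 2) * dpsi y).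
  by move=> /D0 yy; rewrite !mulr_ge0 ?(ltW (P0 y yy)) ?(ltW (gumbel_pdf_gt0 _ _)).
have L0 y : `[y1, +oo[%classic y -> 0 <= gumbel_pdf (psi y) `^ beta * dpsi y.
  by move=> /D0 yy; rewrite mulr_ge0 ?powR_ge0 ?(ltW (P0 y yy)).
have split := integral_setT_split R (psi y1) _ ml (fun x => powR_ge0 _ _).
split.
  apply: (@le_trans _ _ _ _ _ (le1 _ _ _ _)) => //.
    by move=> y /D0 yy; have := le y yy; rewrite ler_norml => /andP[_]; lra.
  rewrite EL split; apply: leeD => //.
  by rewrite leeDr//; apply: integral_ge0 => x _; rewrite lee_fin powR_ge0.
rewrite split [leLHS]addeC EFinD [leRHS]addeA; apply: leeD.
  rewrite -EL; apply: (@le_trans _ _ _ _ _ (le2 _ _ _ _)) => //.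
    by move=> y /D0 yy; have := le y yy; rewrite ler_norml => /andP[+ _]; lra.
  exact: leeD.
(* The part of the limit integral below psi(y1) is at most the Gumbel mass there, because the
   density is at most 1 and beta > 1. *)
rewrite -integral_gumbel_pdf_Ny -integral_itv_bndo_bndc; last first.
  apply/measurable_EFinP; apply: measurable_funTS; apply: continuous_measurable_fun.
  exact: continuous_gumbel_pdf.
apply: ge0_le_integral => //=.
- by move=> x _; rewrite lee_fin powR_ge0.
- by apply/measurable_EFinP; exact: measurable_funTS.
- apply/measurable_EFinP; apply: measurable_funTS; apply: continuous_measurable_fun.
  exact: continuous_gumbel_pdf.
- by move=> x _; rewrite lee_fin powR_gumbel_pdf_le// ltW.
Qed.

End comparison.

(** * The power integral of the density of the maximum *)

(** The left side is n^beta a^(beta - 1) q^beta; inserting a = O(n) produces the exponent 2 beta -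
    1, and q^beta <= q. *)
Lemma powR_tail_le (R : realType) (beta a Ca q : R) (n : nat) :
  1 < beta -> (0 < n)%N -> 0 < a -> 0 < Ca -> a <= Ca * n%:R -> 0 < q <= 1 ->
  a^-1 * (n%:R * a * q) `^ beta <= Ca `^ (beta - 1) * (n%:R `^ (2 * beta - 1) * q).
Proof.
move=> b1 n_gt0 a0 Ca0 aC /andP[q0 q1].
have b0 : 0 < beta by lra.
have n0 : 0 < (n%:R : R) by rewrite ltr0n.
rewrite !powRM ?mulr_ge0 ?(ltW n0) ?(ltW a0) ?(ltW q0)//.
have -> : a `^ beta = a * a `^ (beta - 1) by rewrite mulr_powRB1 ?(ltW a0).
have -> : a^-1 * (n%:R `^ beta * (a * a `^ (beta - 1)) * q `^ beta) =
    a `^ (beta - 1) * (n%:R `^ beta * q `^ beta) by field; rewrite gt_eqF.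
have qb : q `^ beta <= q by apply: ge1r_powR; rewrite ?q0 ?q1// ltW.
have ab : a `^ (beta - 1) <= Ca `^ (beta - 1) * n%:R `^ (beta - 1).
  rewrite -powRM ?(ltW Ca0) ?(ltW n0)//.
  by apply: ge0_ler_powR; rewrite ?nnegrE ?mulr_ge0 ?(ltW Ca0) ?(ltW n0) ?(ltW a0)//; lra.
apply: (@le_trans _ _ ((Ca `^ (beta - 1) * n%:R `^ (beta - 1)) * (n%:R `^ beta * q))).
  by apply: ler_pM; rewrite ?mulr_ge0 ?powR_ge0// ler_wpM2l ?powR_ge0.
have -> : 2 * beta - 1 = (beta - 1) + beta by ring.
rewrite (@powRD _ n%:R (beta - 1)); last by rewrite (gt_eqF n0) implybT.
by rewrite le_eqVlt; apply/orP; left; apply/eqP; ring.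
Qed.

(** Bookkeeping of errors: [il] and [ir] are the integrals below and above y1, [J] the Gumbel
    integral, [g] the Gumbel mass below psi(y1), [Y] a power of n times a geometric term, and [X]
    stands for n e^(-sqrt n). *)
Lemma powint_error_bound (R : realType) (il ir J C3 C4 C5 h X Y g : R) :
  0 <= il -> il <= C4 * Y -> ir <= J + 2 * (C5 * h) ->
  J <= ir + (2 * (C5 * h) + g) -> g <= Y -> Y <= C3 * X ->
  0 <= C3 -> 0 <= C4 -> 0 <= C5 -> 0 <= h -> 0 <= X ->
  `|il + ir - J| <= (2 * C5 + (C4 + 1) * C3) * (h + X).
Proof.
move=> il0 lower up1 up2 gY YX C30 C40 C50 h0 X0.
have E4 := ler_wpM2l C40 YX.
have p1 : 0 <= (C4 + 1) * C3 * h by rewrite !mulr_ge0 ?addr_ge0.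
have p2 : 0 <= 2 * C5 * X by rewrite !mulr_ge0.
have p3 : 0 <= C4 * (C3 * X) by rewrite !mulr_ge0.
have p4 : 0 <= C3 * X by rewrite mulr_ge0.
by rewrite ler_norml; apply/andP; split; lra.
Qed.

Section tail.
Variables (R : realType) (F : cumulativeBounded (0 : R) (1 : R)) (f : R -> R).
Hypothesis F_density : is_density F f.
Hypothesis F_deriv : forall x, inner F x -> is_derive x 1 (F : R -> R) (f x).
Hypothesis f_deriv : forall x, inner F x -> derivable f x 1.
Hypothesis f_gt0 : forall x, inner F x -> 0 < f x.
Hypothesis u'_cvg0 : aux_u' F x @[x --> at_left_ereal (rend F)] --> 0.
Variables (k : R) (n0 : nat).
Hypothesis k_gt0 : 0 < k.
Hypothesis ratio_le : forall n, (n0 <= n)%N ->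
     ((aux_u F (norm_b F n))%:E / ((norm_b F n)%:E * aux_h F (norm_b F n))
        <= k%:E)%E.
Variables (b d : R).
Hypothesis b_gt0 : 0 < b.
Hypothesis d_gt0 : 0 < d.
Hypothesis h_ratio_le : forall (c : R) (n : nat), c < k^-1 -> (n0 <= n)%N ->
     inner F (norm_b F n * (1 - c * k)) ->
     (aux_h F (norm_b F n * (1 - c * k)) / aux_h F (norm_b F n)
        <= (d * (1 - c * k) `^ (- b))%:E)%E.

Let Fnd : {homo (F : R -> R) : x y / x <= y} := @cumulative_is_nondecreasing R _ _ F.
Let Einner := inner_cdf R F f F_density.
Let ib := inner_norm_b R F f F_density F_deriv f_gt0.
Let Fb := cdf_norm_b R F f F_density F_deriv f_gt0.
Let u0 := aux_u_gt0 R F f F_density F_deriv f_gt0.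
Let F_lt1 := cdf_lt1 R F f F_density F_deriv f_gt0 u'_cvg0 k n0 k_gt0 ratio_le
  b d b_gt0 d_gt0 h_ratio_le.
Let rendT := rend_gt R F f F_density F_deriv f_gt0 u'_cvg0 k n0 k_gt0 ratio_le
  b d b_gt0 d_gt0 h_ratio_le.
Let hr x := fine (aux_h F x).
Let eta := Defs.eta F.
Let u := aux_u F.
Let bn := norm_b F.

(** The abstract estimates apply from an index [N] at which h(b_N) <= eps and b_N > 0; beyond b_N
    the function h is finite and [hr] represents it. The exponential bound on u(b_n) is kept in
    order to derive a_n = O(n). *)
Lemma growth_norm_b (eps : R) : 0 < eps -> eps <= 1 -> exists N D : _,
  [/\ (1 < N)%N, 0 < D,
   (forall y, bn N <= y -> inner F y),
   (forall n, (N <= n)%N -> [/\ bn N <= bn n, 0 <= hr (bn n),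
      aux_h F (bn n) = (hr (bn n))%:E & u (bn n) <= expR (eta (bn n) - eta (bn N)) * u (bn N)])
   & (forall n y, (N <= n)%N -> bn N <= y ->
      `|ln (u (bn n)) - ln (u y)| <=
        D * hr (bn n) * (`|eta y - eta (bn n)| * (1 + `|eta y - eta (bn n)|)) /\
      `|ln (u (bn n)) - ln (u y)| <= eps * `|eta y - eta (bn n)|)].
Proof.
move=> eps0 eps1.
have [N1 HN1] := aux_h_norm_b_le R F f F_density F_deriv f_gt0 u'_cvg0 eps eps0.
have [N2 HN2] := norm_b_ge R F f F_density F_deriv f_gt0 0 (F_lt1 0).
pose N := maxn (maxn N1 N2) n0.
have N1N : (N1 <= N)%N by rewrite /N !leq_max leqnn.
have N2N : (N2 <= N)%N by rewrite /N !leq_max leqnn orbT.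
have n0N : (n0 <= N)%N by rewrite /N !leq_max leqnn orbT.
have [N_gt1 bN_ge0] := HN2 N N2N.
have bN0 : 0 < bn N.
  by rewrite lt_def bN_ge0 andbT; exact: (norm_b_neq0 R F f F_density F_deriv f_gt0 k n0 ratio_le N N_gt1 n0N).
have mono m n : (1 < m)%N -> (m <= n)%N -> bn m <= bn n.
  move=> m1 mn; have n1 := leq_trans m1 mn.
  apply: (le_norm_b R F f F_density F_deriv f_gt0) => //; rewrite Fb//.
  by rewrite lerD2l lerN2 lef_pV2 ?posrE ?ltr0n ?(ltnW n1) ?(ltnW m1)// ler_nat.
have bn_ge n : (N <= n)%N -> bn N <= bn n by exact: mono.
have inn y : bn N <= y -> inner F y.
  move=> yy; apply/Einner; rewrite F_lt1 andbT.
  by apply: (lt_le_trans _ (Fnd _ _ yy)); have /Einner/andP[] := ib N N_gt1.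
have hN : (aux_h F (bn N) <= eps%:E)%E by exact: HN1.
have hfin x : bn N <= x -> aux_h F x = (hr x)%:E.
  move=> xx; rewrite /hr fineK// ge0_fin_numE ?aux_h_ge0 ?rendT//.
  exact: le_lt_trans (le_trans (aux_h_noninc _ _ _ _ xx) hN) (ltry _).
have hle : hr (bn N) <= eps by rewrite -lee_fin -hfin.
have du_le x y : bn N <= x -> x < y -> `|aux_u' F y| <= hr x.
  by move=> xx xy; rewrite -lee_fin -hfin//; apply: aux_h_ge => //; exact: rendT.
have h_noninc x y : bn N <= x -> x <= y -> hr y <= hr x.
  by move=> xx xy; rewrite -lee_fin -!hfin ?(le_trans xx)//; exact: aux_h_noninc.
have deta y : bn N <= y -> is_derive y 1 eta (u y)^-1.
  by move=> yy; apply: (is_derive_eta_aux_u R F f F_density F_deriv); exact: inn.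
have du y : bn N <= y -> is_derive y 1 u (aux_u' F y).
  by move=> yy; apply: (is_derive_aux_u R F f F_density F_deriv f_deriv f_gt0); exact: inn.
have u_gt0 y : bn N <= y -> 0 < u y by move=> yy; apply: u0; exact: inn.
have h1 : hr (bn N) <= 1 by exact: le_trans eps1.
have step y : bn N <= y -> exists n, [/\ (N <= n)%N,
    bn n <= y, y <= bn n.+1 & eta (bn n.+1) - eta (bn n) <= 3].
  move=> yy; have /Einner/andP[Fy0 Fy1] := inn y yy.
  have Fy : 0 < 1 - F y by rewrite subr_gt0.
  (* The integer with n <= 1 / (1 - F y) < n + 1, that is, 1 - 1/n <= F y < 1 - 1/(n + 1). *)
  pose n := Num.truncn (1 - F y)^-1.
  have V0 : 0 < (1 - F y)^-1 by rewrite invr_gt0.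
  have Nn : (N <= n)%N.
    rewrite -(ltnS N) -(ltr_nat R); apply: le_lt_trans (truncnS_gt _).
    rewrite -[leLHS]invrK lef_pV2 ?posrE ?invr_gt0 ?ltr0n ?(ltnW N_gt1)//.
    by rewrite lerBlDr -lerBlDl -Fb//; exact: Fnd.
  have n1 : (1 < n)%N by exact: leq_trans Nn.
  have nr0 : 0 < (n%:R : R) by rewrite ltr0n ltnW.
  exists n; split => //.
  - apply: (norm_b_le R F f F_density F_deriv f_gt0) => //.
    rewrite lerBlDr -lerBlDl -[leLHS]invrK lef_pV2 ?posrE ?invr_gt0//.
    by rewrite truncn_le ltW.
  - apply: (le_norm_b R F f F_density F_deriv f_gt0); first exact: ltnW.
    rewrite lerBrDr -lerBrDl -[leRHS]invrK lef_pV2 ?posrE ?invr_gt0 ?ltr0n//.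
    exact/ltW/truncnS_gt.
  - have := eta_norm_b R F f F_density F_deriv f_gt0 n n1.
    have := eta_norm_b R F f F_density F_deriv f_gt0 n.+1 (ltnW n1).
    rewrite -/eta -/bn !ler_norml => /andP[_ l2] /andP[l1 _].
    have : ln n.+1%:R - ln n%:R <= 1 :> R.
      rewrite -ln_div ?posrE ?ltr0n ?(ltnW n1)//.
      have -> : n.+1%:R / n%:R = 1 + n%:R^-1 :> R.
        by rewrite -natr1 mulrDl mul1r divff ?gt_eqF.
      apply: (le_trans (le_ln1Dx _)); first by apply: (lt_trans (ltrN10 _)); rewrite invr_gt0.
      by rewrite invf_le1// ler1n ltnW.
    lra.
have Hratio n y : (N <= n)%N -> bn N <= y -> hr y <= d * (y / bn n) `^ (- b) * hr (bn n).
  move=> Nn yy; have bn0 : 0 < bn n by exact: lt_le_trans (bn_ge n Nn).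
  rewrite -lee_fin EFinM -!hfin ?bn_ge//.
  apply: (aux_h_ratio R F f F_density F_deriv f_gt0 k n0 k_gt0 ratio_le b d h_ratio_le).
  - exact: leq_trans Nn.
  - exact: leq_trans Nn.
  - exact: inn.
  - by rewrite divr_gt0// (lt_le_trans bN0).
  - by rewrite -/bn hfin ?bn_ge// ltry.
have uratio n : (N <= n)%N -> u (bn n) <= k * (bn n * hr (bn n)).
  move=> Nn; have bn0 : 0 < bn n by exact: lt_le_trans (bn_ge n Nn).
  have n0n := leq_trans n0N Nn; have n1 := leq_trans N_gt1 Nn.
  have := ratio_le n n0n.
  have := aux_h_gt0 R F f F_density F_deriv f_gt0 k n0 ratio_le n n1 n0n.
  rewrite -/bn hfin ?bn_ge// lte_fin => h0.
  by rewrite -EFinM inver gt_eqF ?mulr_gt0// -EFinM lee_fin ler_pdivrMr ?mulr_gt0.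
have [D D0 HD] := ln_u_bound R eta u (aux_u' F) hr bn N b d k bN0 b_gt0 d_gt0 k_gt0
  deta du u_gt0 du_le h_noninc h1 bn_ge step Hratio uratio.
exists N, D; split => //.
  move=> n Nn; have bnn := bn_ge n Nn; split => //.
  - by rewrite -lee_fin -hfin// aux_h_ge0.
  - exact: hfin.
  - by have [] := u_bound_of_increment R eta u (aux_u' F) hr bn N deta du u_gt0 du_le h_noninc h1
      (bn N) (bn n) _ (lexx _) bnn (lexx _).
move=> n y Nn yy; split; first exact: HD.
apply: le_trans (ln_u_bound_linear R eta u (aux_u' F) hr bn N deta du u_gt0 du_le h_noninc bn_ge n y Nn yy) _.
by rewrite ler_wpM2r.
Qed.

(** Since F = exp (- e^(- eta)), shifting eta by ln n multiplies the exponent by n. *)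
Lemma gumbel_cdf_eta y n : (0 < n)%N -> inner F y -> gumbel_cdf (eta y - ln n%:R) = F y ^+ n.
Proof.
move=> n_gt0 iy; have /Einner/andP[F0 F1] := iy.
rewrite /gumbel_cdf opprB expRD lnK ?posrE ?ltr0n// /eta /Defs.eta opprK lnK; last first.
  by rewrite posrE oppr_gt0 ln_lt0// F0.
by rewrite mulrN opprK expRM_natl lnK.
Qed.

Lemma gumbel_pdf_eta y n a : (0 < n)%N -> inner F y ->
  n%:R * a * f y * F y ^+ n.-1 = gumbel_pdf (eta y - ln n%:R) * (a / u y).
Proof.
move=> n_gt0 iy; have /Einner/andP[F0 F1] := iy.
have f0 := f_gt0 y iy; have l0 : ln (F y) < 0 by rewrite ln_lt0// F0.
rewrite /gumbel_pdf -/(gumbel_cdf _) gumbel_cdf_eta//.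
rewrite opprB expRD lnK ?posrE ?ltr0n// /eta /Defs.eta opprK lnK ?posrE ?oppr_gt0//.
rewrite /u (aux_uE R F f F_density F_deriv y iy).
have -> : F y ^+ n = F y * F y ^+ n.-1 by rewrite -exprS prednK.
have fN : f y != 0 by rewrite gt_eqF.
have FN : F y != 0 by rewrite gt_eqF.
have lN : ln (F y) != 0 by rewrite lt_eqF.
by field; rewrite ?oppr_eq0 ?fN ?FN ?lN.
Qed.

Lemma cvgy_eta : eta y @[y --> +oo] --> +oo.
Proof.
apply/cvgryPge => A.
have [N HN] := norm_b_ge R F f F_density F_deriv f_gt0 0 (F_lt1 0).
pose n := maxn N (Num.truncn (expR (A + 1))).+1.
have [n1 _] := HN n (leq_maxl _ _).
have An : A + 1 <= ln n%:R.
  rewrite -[leLHS]expRK ler_ln ?posrE ?expR_gt0 ?ltr0n ?(ltnW n1)//.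
  by rewrite (le_trans (ltW (truncnS_gt _)))// ler_nat leq_maxr.
have bA : A <= eta (bn n).
  have := eta_norm_b R F f F_density F_deriv f_gt0 n n1.
  by rewrite -/eta -/bn ler_norml => /andP[l _]; lra.
exists (bn n); split; first exact: num_real.
move=> y by_; apply: (le_trans bA).
have /Einner/andP[B0 B1] := ib n n1.
rewrite /eta /Defs.eta lerN2 ler_ln ?posrE ?oppr_gt0 ?ln_lt0 ?F_lt1 ?B0 ?andbT//; last first.
  exact: lt_le_trans (Fnd _ _ (ltW by_)).
rewrite lerN2 ler_ln ?posrE//; first exact: Fnd _ _ (ltW by_).
exact: lt_le_trans (Fnd _ _ (ltW by_)).
Qed.

Lemma powint_max_pdf (beta : R) : 1 < beta ->
  (\int[lebesgue_measure]_x (f x `^ beta)%:E < +oo)%E ->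
  exists C N, 0 < C /\ forall n, (N <= n)%N ->
    [/\ (1 < n)%N, 0 <= hr (bn n), aux_h F (bn n) = (hr (bn n))%:E &
     exists2 I, (\int[lebesgue_measure]_x (max_pdf F f n x `^ beta)%:E = I%:E)%E
      & `|I - fine (\int[lebesgue_measure]_x (@gumbel_pdf R x `^ beta)%:E)%E|
         <= C * (hr (bn n) + n%:R * expR (- Num.sqrt n%:R))].
Proof.
move=> b1 fint; have [mf f0 _] := F_density.
have aux1 (x y z : R) : `|x - z| <= 1 -> x - y <= 1 - y + z.
  by rewrite ler_norml => /andP[_]; lra.
have b0 : 0 < beta by lra.
have bp : 0 <= beta - 1 by lra.
have b2 : 0 <= 2 * beta - 1 by lra.
have Fc : continuous F := density_continuous R F f F_density.
have mF : measurable_fun [set: R] F by exact: continuous_measurable_fun.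
have F0 : forall y, 0 <= F y := cdf_ge0 R F.
(* Chosen so that (beta - 1) eps <= 1/4, the slope allowed in [gumbel_perturbation]. *)
pose eps : R := (4 * beta)^-1.
have eps0 : 0 < eps by rewrite invr_gt0 mulr_gt0.
have eps1 : eps <= 1 by rewrite invf_le1 ?mulr_gt0//; lra.
have beps : (beta - 1) * eps <= 4^-1.
  by rewrite /eps ler_pdivrMr ?mulr_gt0//; lra.
have [N [D [N1 D0 inn HN HD]]] := growth_norm_b eps eps0 eps1.
pose y1 := bn N; pose q := F y1.
have q01 : 0 < q < 1 by apply/Einner/inn/lexx.
have uy1 : 0 < u y1 by apply: u0; apply: inn.
(* From u(b_n) <= e^(eta(b_n) - eta(y1)) u(y1) and eta(b_n) <= ln n + 1, which give a_n <= Ca n. *)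
pose Ca := expR (1 - eta y1) * u y1.
have Ca0 : 0 < Ca by rewrite mulr_gt0 ?expR_gt0.
have mfb : measurable_fun [set: R] (fun x => f x `^ beta)
  by apply: (@measurableT_comp _ _ _ _ _ _ (fun x : R => x `^ beta) _ f).
set Kf := (\int[lebesgue_measure]_x (f x `^ beta)%:E)%E in fint.
have Kf0 : (0 <= Kf)%E by apply: integral_ge0 => x _; rewrite lee_fin powR_ge0.
have KfE : Kf = (fine Kf)%:E by rewrite fineK// ge0_fin_numE.
have [C3 C30 HC3] := powR_expn_le R (2 * beta - 1) q ltac:(lra) q01.
pose C4 := fine Kf * Ca `^ (beta - 1).
have C40 : 0 <= C4 by rewrite mulr_ge0 ?powR_ge0// -lee_fin -KfE.
pose C5 := 64 * expR 2 * ((beta - 1) * D).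
have C50 : 0 < C5 by rewrite !mulr_gt0 ?expR_gt0// subr_gt0.
exists (2 * C5 + (C4 + 1) * C3), N; split.
  by apply: addr_gt0; apply: mulr_gt0 => //; exact: ltr_wpDl.
move=> n Nn; have [bn_ge h0 hE ule] := HN n Nn.
have n1 : (1 < n)%N by exact: leq_trans Nn.
have n_gt0 : (0 < n)%N by exact: ltnW.
have nr0 : 0 < (n%:R : R) by rewrite ltr0n.
split => //.
pose a := u (bn n); have a0 : 0 < a by apply: u0; apply: inn.
have tn : `|eta (bn n) - ln n%:R| <= 1 by exact: (eta_norm_b R F f F_density F_deriv f_gt0 n n1).
have aCa : a <= Ca * n%:R.
  rewrite -/y1 in ule; apply: (le_trans ule).
  have -> : Ca * n%:R = expR (1 - eta y1) * n%:R * u y1 by rewrite /Ca mulrAC.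
  rewrite (ler_pM2r uy1).
  have nE : n%:R = expR (ln n%:R) :> R by rewrite lnK ?posrE.
  rewrite [X in _ <= _ * X]nE -expRD ler_expR.
  exact: aux1.
pose Q y := (n%:R * a * f y * F y ^+ n.-1) `^ beta.
have mQ : measurable_fun [set: R] Q.
  apply: (@measurableT_comp _ _ _ _ _ _ (fun x : R => x `^ beta) _
    (fun y => n%:R * a * f y * F y ^+ n.-1)) => //.
  apply: measurable_funM; last exact: measurable_funX.
  by apply: measurable_funM => //; exact: measurable_cst.
pose A y := a^-1 * Q y.
have mA : measurable_fun [set: R] A by apply: measurable_funM => //; exact: measurable_cst.
have A0 y : 0 <= A y by apply: mulr_ge0; [rewrite invr_ge0 ltW|exact: powR_ge0].
have intE : (\int[lebesgue_measure]_x (max_pdf F f n x `^ beta)%:E =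
    \int[lebesgue_measure]_y (A y)%:E)%E.
  rewrite (ge0_integral_affine R a (bn n) Q a0 mQ (fun y => powR_ge0 _ _)).
  rewrite -ge0_integralZl//=.
  - exact/measurable_EFinP.
  - by move=> y _; rewrite lee_fin powR_ge0.
  - by rewrite lee_fin invr_ge0 ltW.
have lower : (\int[lebesgue_measure]_(y in `]-oo, y1[) (A y)%:E <=
    (C4 * (n%:R `^ (2 * beta - 1) * q ^+ n.-1))%:E)%E.
  (* On this range F <= q, so [A] is at most [cl] times f^beta. *)
  pose cl := a^-1 * (n%:R * a * q ^+ n.-1) `^ beta.
  have cl0 : 0 <= cl by apply: mulr_ge0; [rewrite invr_ge0 ltW|exact: powR_ge0].
  have q1 : 0 < q ^+ n.-1 <= 1.
    by have /andP[q0 q1] := q01; rewrite exprn_gt0//= exprn_ile1// ltW.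
  apply: (@le_trans _ _ (cl%:E * Kf)%E); last first.
    rewrite KfE -EFinM lee_fin /C4 mulrC -mulrA ler_wpM2l ?fine_ge0//.
    exact: powR_tail_le.
  rewrite -ge0_integralZl; last 4 first.
  - exact: measurableT.
  - exact/measurable_EFinP.
  - by move=> y _; rewrite lee_fin powR_ge0.
  - by rewrite lee_fin.
  apply: (@le_trans _ _ (\int[lebesgue_measure]_(y in `]-oo, y1[) (cl%:E * (f y `^ beta)%:E))%E).
    apply: ge0_le_integral.
    + exact: measurable_itv.
    + by move=> y _; rewrite lee_fin; exact: A0.
    + by apply/measurable_EFinP; exact: measurable_funTS.
    + by apply/measurable_EFinP; apply: measurable_funTS; apply: measurable_funM; [exact: measurable_cst|exact: mfb].
    + move=> y /=; rewrite in_itv/= => yy; rewrite -EFinM lee_fin /A /cl -[leRHS]mulrA.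
      have fy0 := f0 y; have Fy0 := F0 y; have na0 : 0 <= n%:R * a by rewrite mulr_ge0 ?ltW.
      apply: ler_wpM2l; first by rewrite invr_ge0 ltW.
      have q0 : 0 <= q ^+ n.-1 by have /andP[/ltW + _] := q1.
      rewrite -powRM//; last exact: mulr_ge0.
      apply: ge0_ler_powR; rewrite ?nnegrE; first exact: ltW.
      * by apply: mulr_ge0; [exact: mulr_ge0|exact: exprn_ge0].
      * by apply: mulr_ge0 => //; exact: mulr_ge0.
      rewrite [leRHS]mulrAC; apply: ler_wpM2l; first exact: mulr_ge0.
      by apply: lerXn2r; rewrite ?nnegrE//; [exact: F0|exact/Fnd/ltW].
  apply: ge0_subset_integral => //=.
    by apply/measurable_EFinP; apply: measurable_funM; [exact: measurable_cst|exact: mfb].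
  by move=> y _; rewrite lee_fin mulr_ge0 ?powR_ge0.
pose psi y := eta y - ln n%:R.
have upper y : y1 <= y -> `|A y - gumbel_pdf (psi y) `^ beta * (u y)^-1| <=
    C5 * hr (bn n) * (gumbel_pdf (psi y / 2) * (u y)^-1).
  move=> yy; have uy : 0 < u y by apply: u0; exact: inn.
  (* One power of a / u, against the prefactor 1 / a, gives the density 1 / u of psi; [w] is the
     logarithm of the remaining (a / u)^(beta - 1). *)
  pose w := (beta - 1) * (ln a - ln (u y)).
  have -> : A y = gumbel_pdf (psi y) `^ beta * expR w * (u y)^-1.
    rewrite /A /Q (gumbel_pdf_eta y n a n_gt0 (inn y yy)) -/(psi y).
    rewrite powRM ?(ltW (gumbel_pdf_gt0 _ _)) ?divr_ge0 ?(ltW a0) ?(ltW uy)//.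
    rewrite -(mulr_powRB1 (_ : 0 <= a / u y) b0) ?divr_ge0 ?(ltW a0) ?(ltW uy)//.
    have -> : (a / u y) `^ (beta - 1) = expR w.
      by rewrite /powR gt_eqF ?divr_gt0// ln_div ?posrE.
    by field; rewrite !gt_eqF.
  have uVy : 0 <= (u y)^-1 by rewrite ltW// invr_gt0.
  rewrite -mulrBl normrM (ger0_norm uVy) mulrA; apply: (ler_wpM2r uVy).
  have [w1 w2] := HD n y Nn yy.
  have nw : `|w| = (beta - 1) * `|ln a - ln (u y)| by rewrite /w normrM ger0_norm.
  rewrite (_ : C5 * hr (bn n) = 64 * expR 2 * ((beta - 1) * D * hr (bn n))); last by rewrite /C5; ring.
  apply: (gumbel_perturbation R beta (psi y) `|eta y - eta (bn n)|) => //.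
  - exact: ltW.
  - have -> : eta y - eta (bn n) = psi y - (eta (bn n) - ln n%:R) by rewrite /psi opprB addrA subrK.
    by apply: (le_trans (ler_normB _ _)); rewrite lerD2l.
  - by rewrite !mulr_ge0// ltW.
  - by rewrite nw -mulrA -mulrA ler_wpM2l// mulrA.
  - rewrite nw; apply: (le_trans (ler_wpM2l bp w2)); rewrite mulrA.
    by rewrite [leRHS]mulrC; apply: ler_wpM2r.
have dpsi y : y1 <= y -> is_derive y 1 psi (u y)^-1.
  move=> yy; rewrite -[X in is_derive _ _ _ X]subr0.
  apply: is_deriveB.
  by apply: (is_derive_eta_aux_u R F f F_density F_deriv); exact: inn.
have cdpsi y : y1 <= y -> {for y, continuous (fun z => (u z)^-1)}.
  move=> yy; apply: continuousV; first by rewrite gt_eqF// u0//; exact: inn.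
  apply: differentiable_continuous; apply/derivable1_diffP.
  by have [] := is_derive_aux_u R F f F_density F_deriv f_deriv f_gt0 y (inn y yy).
have psiy : psi y @[y --> +oo] --> +oo.
  apply/cvgryPge => B; move/cvgryPge : cvgy_eta => /(_ (B + ln n%:R)).
  by apply: filterS => y; rewrite /psi lerBrDr.
have ch0 : 0 <= C5 * hr (bn n) by apply: mulr_ge0 => //; exact: ltW.
have [up1 up2] := integral_gumbel_comparison R beta b1 psi (fun y => (u y)^-1) A y1 (C5 * hr (bn n))
  dpsi (fun y yy => ltac:(rewrite invr_gt0; apply: u0; exact: inn)) cdpsi psiy mA A0 ch0 upper.
have Jfin := integral_powR_gumbel_pdf_fin R beta b1.
set Jb := (\int[lebesgue_measure]_x (gumbel_pdf x `^ beta)%:E)%E in up1 up2 Jfin *.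
(* The Gumbel mass below psi(y1) equals q^n, so it fits in the error term of the lower range. *)
have cdfE : gumbel_cdf (psi y1) <= n%:R `^ (2 * beta - 1) * q ^+ n.-1.
  rewrite /psi gumbel_cdf_eta//; last exact: inn.
  have /andP[q0 q1] := q01.
  rewrite -/q -[leLHS]mul1r ler_pM ?exprn_ge0 ?(ltW q0)//.
    by rewrite -[leLHS](powRr0 n%:R) ler_powR ?ler1n.
  by rewrite ler_wiXn2l ?leq_pred ?(ltW q0) ?(ltW q1).
have split := integral_setT_split R y1 A mA A0.
rewrite -intE in split.
have l0 : (0 <= \int[lebesgue_measure]_(y in `]-oo, y1[) (A y)%:E)%E.
  by apply: integral_ge0 => y _; rewrite lee_fin.
have r0 : (0 <= \int[lebesgue_measure]_(y in `[y1, +oo[) (A y)%:E)%E.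
  by apply: integral_ge0 => y _; rewrite lee_fin.
move: split l0 r0 lower up1 up2.
set IL := (\int[lebesgue_measure]_(y in `]-oo, y1[) (A y)%:E)%E.
set IR := (\int[lebesgue_measure]_(y in `[y1, +oo[) (A y)%:E)%E.
rewrite -(fineK Jfin); set J := fine Jb.
case: IL => [il| |]//; case: IR => [ir| |]// -> il0 ir0.
rewrite -!EFinD !lee_fin in il0 ir0 * => lower up1 up2.
exists (il + ir) => //.
have E := HC3 n n_gt0.
apply: (powint_error_bound R il ir J C3 C4 C5 _ _ _ _ il0 lower up1 up2 cdfE E) => //.
- exact: ltW.
- exact: ltW.
Qed.

End tail.

(** * From power integrals to Rényi entropies *)

Lemma renyi_entropyE (R : realType) (beta I : R) (p : R -> R) :
  beta != 0 -> (forall x, 0 <= p x) -> 0 < I ->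
  (\int[lebesgue_measure]_x (p x `^ beta)%:E = I%:E)%E ->
  renyi_entropy beta p = ((1 - beta)^-1 * ln I)%:E.
Proof.
move=> b0 p0 I0 pI; rewrite /renyi_entropy integral_mkcond.
rewrite (_ : \int[_]_x _ = I%:E)%E ?lne_EFin// -pI.
apply: eq_integral => x _; rewrite /patch; case: ifPn => // /negP xp.
suff -> : p x = 0 by rewrite powR0.
by apply/eqP; rewrite eq_le p0 andbT leNgt; apply/negP => px; apply: xp; rewrite inE.
Qed.

Theorem theorem3p3 (R : realType)
  (F : cumulativeBounded (0 : R) (1 : R)) (f : R -> R)
  (F_density : is_density F f)
  (F_deriv : forall x, inner F x -> is_derive x 1 (F : R -> R) (f x))
  (f_deriv : forall x, inner F x -> derivable f x 1)
  (f_gt0 : forall x, inner F x -> 0 < f x)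
  (F_domain : gumbel_domain F)
  (u'_cvg0 : aux_u' F x @[x --> at_left_ereal (rend F)] --> 0)
  (k : R) (n0 : nat) (k_gt0 : 0 < k)
  (ratio_le : forall n, (n0 <= n)%N ->
     ((aux_u F (norm_b F n))%:E / ((norm_b F n)%:E * aux_h F (norm_b F n))
        <= k%:E)%E)
  (b d : R) (b_gt0 : 0 < b) (d_gt0 : 0 < d)
  (h_ratio_le : forall (c : R) (n : nat), c < k^-1 -> (n0 <= n)%N ->
     inner F (norm_b F n * (1 - c * k)) ->
     (aux_h F (norm_b F n * (1 - c * k)) / aux_h F (norm_b F n)
        <= (d * (1 - c * k) `^ (- b))%:E)%E)
  (beta : R) (beta_gt1 : 1 < beta)
  (f_bounded : (ereal_sup [set (f x)%:E | x in [set: R]] < +oo)%E)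
  (f_decreasing : exists x0 : R, (x0%:E < rend F)%E /\
     forall x y : R, x0 < x -> x <= y -> (y%:E < rend F)%E -> f y <= f x)
  (f_powint : (\int[lebesgue_measure]_x (f x `^ beta)%:E < +oo)%E) :
  exists (C : R) (N : nat), 0 < C /\
    forall n, (N <= n)%N ->
      (`|renyi_entropy beta (max_pdf F f n) - renyi_entropy beta (@gumbel_pdf R)|
       <= C%:E * (aux_h F (norm_b F n) + lne (1 + aux_h F (norm_b F n))
                  + (n%:R * expR (- Num.sqrt n%:R))%:E))%E.
Proof.
have Jfin := integral_powR_gumbel_pdf_fin R beta beta_gt1.
have Jpos := integral_powR_gumbel_pdf_gt0 R beta beta_gt1.
have [C [N1 [C0 HC]]] := powint_max_pdf R F f F_density F_deriv f_deriv f_gt0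
  u'_cvg0 k n0 k_gt0 ratio_le b d b_gt0 d_gt0 h_ratio_le beta beta_gt1 f_powint.
set J := fine _ in HC.
have JE : (\int[lebesgue_measure]_x (gumbel_pdf x `^ beta)%:E = J%:E)%E by rewrite /J fineK.
have J0 : 0 < J by rewrite -lte_fin -JE.
(* With h(b_n) and n e^(-sqrt n) both at most [e], the error C (h + X) is at most J / 2, as
   [ler_dist_ln] requires. *)
pose e := J / (4 * C).
have e0 : 0 < e by rewrite divr_gt0// mulr_gt0.
have [N2 HN2] := aux_h_norm_b_le R F f F_density F_deriv f_gt0 u'_cvg0 e e0.
(* From this index on 256 / n <= e, and 256 / n dominates n e^(-sqrt n). *)
pose N3 := (Num.truncn (256 / e)).+1.
pose B := `|(1 - beta)^-1|.
have bneq : (1 - beta)^-1 != 0 by rewrite invr_eq0 subr_eq0 lt_eqF.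
have B0 : 0 < B by rewrite normr_gt0.
exists (B * (2 / J * C)), (maxn N1 (maxn N2 N3)); split.
  by rewrite mulr_gt0// mulr_gt0// divr_gt0.
move=> n; rewrite !geq_max => /andP[N1n /andP[N2n N3n]].
have [n_gt1 h0 hE [I IE IJ]] := HC n N1n.
set h := fine _ in h0 hE IJ.
set X := n%:R * expR _ in IJ *.
have n_gt0 : (0 < n)%N by exact: ltnW.
have nr0 : 0 < (n%:R : R) by rewrite ltr0n.
have X0 : 0 <= X by rewrite mulr_ge0 ?expR_ge0 ?ler0n.
have he : h <= e by rewrite -lee_fin -hE; exact: HN2.
have Xe : X <= e.
  apply: (le_trans (natr_expR_sqrt_le R n n_gt0)).
  rewrite ler_pdivrMr// mulrC -ler_pdivrMr//.
  by apply: (le_trans (ltW (truncnS_gt _))); rewrite ler_nat.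
have Jhalf : C * (h + X) <= J / 2.
  have -> : J / 2 = C * (e + e) by rewrite /e; field; rewrite gt_eqF.
  by rewrite ler_pM2l// lerD.
have I0 : 0 < I.
  by move: IJ; rewrite ler_norml => /andP[l _]; lra.
have hln := ler_dist_ln R I J _ J0 IJ Jhalf.
rewrite (renyi_entropyE R beta J (@gumbel_pdf R))//; last 2 first.
- by rewrite gt_eqF// (lt_trans ltr01).
- by move=> x; exact/ltW/gumbel_pdf_gt0.
rewrite (renyi_entropyE R beta I (max_pdf F f n))//; last 2 first.
- by rewrite gt_eqF// (lt_trans ltr01).
- have [_ f0 _] := F_density.
  have a0 : 0 < norm_a F n.
    apply: (aux_u_gt0 R F f F_density F_deriv f_gt0).
    exact: (inner_norm_b R F f F_density F_deriv f_gt0).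
  move=> x; apply: mulr_ge0; last by apply: exprn_ge0; exact: cdf_ge0.
  by apply: mulr_ge0 => //; apply: mulr_ge0 => //; exact: ltW.
have h1 : 0 < 1 + h by rewrite ltr_wpDr.
have ln0 : 0 <= ln (1 + h) by rewrite ln_ge0// lerDl.
rewrite hE -EFinB -EFinD lne_EFin// -!EFinD -EFinM abse_EFin lee_fin.
rewrite -mulrBr normrM.
apply: (le_trans (ler_wpM2l (normr_ge0 _) hln)).
rewrite -/B (mulrA (2 / J)) (mulrA B) ler_pM2l; first by rewrite lerD2r lerDl.
by rewrite mulr_gt0// mulr_gt0// divr_gt0.
Qed.
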